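(* Let $G=(V,E)$ be an undirected simple graph with $n$ vertices. Let $\mathcal{P}$ be either the maximum cut size problem or the minimum bisection size problem. Let $\Pi$ be any randomized algorithm that, in the random query model, outputs an approximation of the value of $\mathcal{P}$ on $G$ within additive error $\varepsilon n^2$ with probability at least $99/100$. If the worst-case number of queries is $q$ and the space used is at most $\gamma\sqrt n$ bits, then $$q=\begin{cases}\Omega\left(\min\left(\frac{n}{\varepsilon^2\sqrt{\gamma}},\frac{n\sqrt n}{\gamma}\right)\right)&\text{if }\gamma<1,\\ \Omega\left(\frac{n}{\varepsilon^2}\right)&\text{if }\gamma\ge 1,\end{cases}$$ for parameters $\varepsilon\in\left(\omega\left(\frac1{\sqrt n}\right),0.05\right)$ and $\gamma>\omega\left(\frac{\log n}{\sqrt n}\right)$.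
   Context: A cut is given by $P\in\{0,1\}^n$ splitting $V$ into $V_0,V_1$; its size $\mathrm{cut}_G(P)$ is the number of edges between $V_0$ and $V_1$. The max cut size is $\max_P\mathrm{cut}_G(P)$. For even $n$, a bisection is a cut with $|P|=n/2$ (Hamming weight), and the minimum bisection size is $\min_{P:|P|=n/2}\mathrm{cut}_G(P)$. In the random query model, each query returns an independent uniformly random unordered pair $\{u,v\}$ of distinct vertices with the bit $\mathbb{1}_{\{u,v\}\in E}$; the algorithm processes these sequentially with the stated memory. Asymptotics are as $n\to\infty$. *)

(* Defs.v *)
From HB Require Import structures.
From mathcomp Require Export all_boot all_order all_algebra.
From mathcomp Require Export all_classical all_reals all_analysis.

Set Implicit Arguments.
Unset Strict Implicit.
Unset Printing Implicit Defensive.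

Import Order.TTheory GRing.Theory Num.Theory.

Local Open Scope ring_scope.
Local Open Scope classical_set_scope.

Definition vpair (n : nat) : finType := {e : {set 'I_n} | #|e| == 2%N}.

(* A simple undirected graph on the vertex set 'I_n is its set of edges. *)
Definition graph (n : nat) : finType := {set vpair n}.

Definition crosses (n : nat) (P : {ffun 'I_n -> bool}) (e : vpair n) : bool :=
  [exists u, exists v, [&& ~~ P u, P v & val e == [set u; v]%SET]].

Definition cut (n : nat) (G : graph n) (P : {ffun 'I_n -> bool}) : nat :=
  #|[set e in G | crosses P e]%SET|.

Definition maxcut (n : nat) (G : graph n) : nat :=
  \max_(P : {ffun 'I_n -> bool}) cut G P.

Definition is_bisection (n : nat) (P : {ffun 'I_n -> bool}) : bool :=
  #|[set i | P i]%SET| == n./2.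

(* Every cut has size at most #|G|, so the initial value #|G| does not affect
   the minimum. Only meaningful for even n; see [admissible]. *)
Definition minbisection (n : nat) (G : graph n) : nat :=
  \big[minn/#|G|]_(P : {ffun 'I_n -> bool} | is_bisection P) cut G P.

Variant problem := MaxCut | MinBisection.

Definition admissible (p : problem) (n : nat) : bool :=
  if p is MinBisection then ~~ odd n else true.

Definition value (p : problem) (n : nat) (G : graph n) : nat :=
  if p is MinBisection then minbisection G else maxcut G.

(* A randomized algorithm on n-vertex inputs with s bits of memory. The random
   tape w, the step counter t and the current response are not charged to the
   memory, so the model is non-uniform: a distribution over layered branching
   programs of width 2^s. At time t (after t queries) in memory state m, the
   algorithm either stops and outputs [alg_output w t m], if
   [alg_halt w t m], or receives one more response. *)
Record algorithm (R : realType) (n s : nat) := Algorithm {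
  alg_disp : measure_display;
  alg_tape : measurableType alg_disp;
  alg_prob : probability alg_tape R;
  alg_init : alg_tape -> s.-tuple bool;
  alg_step : alg_tape -> nat -> s.-tuple bool -> vpair n * bool ->
    s.-tuple bool;
  alg_halt : alg_tape -> nat -> s.-tuple bool -> bool;
  alg_output : alg_tape -> nat -> s.-tuple bool -> R;
  alg_init_measurable : forall m, measurable [set w | alg_init w = m];
  alg_step_measurable : forall t m x m',
    measurable [set w | alg_step w t m x = m'];
  alg_halt_measurable : forall t m, measurable [set w | alg_halt w t m];
  alg_output_measurable : forall t m,
    measurable_fun [set: alg_tape] (fun w => alg_output w t m)
}.

Fixpoint run_from (R : realType) (n s : nat) (A : algorithm R n s)
    (w : alg_tape A) (t : nat) (m : s.-tuple bool) (xs : seq (vpair n * bool))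
    : option R :=
  if alg_halt w t m then Some (alg_output w t m)
  else if xs is x :: xs' then run_from w t.+1 (alg_step w t m x) xs'
  else None.

(* [None] means that the algorithm still asks for a query after having
   received a response for each pair of es. *)
Definition run (R : realType) (n s : nat) (A : algorithm R n s)
    (w : alg_tape A) (G : graph n) (es : seq (vpair n)) : option R :=
  run_from w 0 (alg_init w) [seq (e, e \in G) | e <- es].

Definition worst_case_queries (R : realType) (n s : nat)
    (A : algorithm R n s) (q : nat) : Prop :=
  forall (w : alg_tape A) (G : graph n) (es : q.-tuple (vpair n)),
    run w G es <> None.

(* The q queried pairs are uniform, independent of each other and of the
   random tape. *)
Definition success_prob (R : realType) (n s : nat) (A : algorithm R n s)
    (q : nat) (G : graph n) (good : set R) : R :=
  (\sum_(es : q.-tuple (vpair n))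
     fine (alg_prob A [set w | exists2 v, run w G es = Some v & good v]))
  / #|{: q.-tuple (vpair n)}|%:R.

Definition approximates (R : realType) (p : problem) (n s : nat)
    (A : algorithm R n s) (q : nat) (eps : R) : Prop :=
  forall G : graph n,
    99 / 100 <= success_prob A q G
      [set v | `|v - (value p G)%:R| <= eps * n%:R ^+ 2].

Definition is_omega (R : realType) (f g : nat -> R) : Prop :=
  forall C : R, 0 < C -> \forall n \near \oo, C * g n <= f n.

(* Main.v *)
Require Import Defs.
From mathcomp Require Import measurable_realfun ring lra zify.

(** The hard distribution plants a uniformly random cut [X]: every pair of
    vertices is an edge with bias [+- 18 eps] according to whether [X] separates
    it, while the reference distribution is the uniform graph. Both problem
    values then concentrate at points more than [2 eps n^2] apart, so that an
    approximation algorithm distinguishes the two distributions.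

    With at most [eps^-2 n] samples, up to a constant, the two transcripts are
    close because the second moment of the likelihood ratio is an exponential
    moment of a quadratic form in random signs.

    With memory of [s] bits, compare both distributions with answers given by
    fresh unbiased bits. If [v] is the acceptance probability under fresh bits
    from the current state, then [v - lam v^2] is almost a supermartingale
    along the true process: its drift at one step is at most [1 / (4 lam)] times
    the mean over all pairs [e] of [a_e^2], where [a_e] is the conditional bias
    of the answer on [e] given the memory state. A level inequality, again from
    the exponential moment of quadratic forms, bounds the sum of the [a_e^2] by
    [O(s + eps^2 s^2)]. *)

Set Implicit Arguments.
Unset Strict Implicit.
Unset Printing Implicit Defensive.

Import Order.TTheory GRing.Theory Num.Theory.
Local Open Scope ring_scope.

(** * Averages over finite types and random signs *)

Section Average.
Variable R : realFieldType.
Implicit Types T U : finType.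

(** A biased answer moves the acceptance probability [v] linearly, by [a_e d] with [d] half the
    difference of the two successor values, and bounding these drifts one by one would be too lossy.
    Subtracting [lam v^2] turns the spread of [v] itself into a gain [lam d^2]; completing the
    square then leaves only [a_e^2].

    Pairs can be queried repeatedly, so the uniform graph does not answer with fresh bits either.
    Both distributions are therefore compared with fresh bits, the uniform graph being the case of
    bias zero, where the cost [O(s)] remains.

    With [s <= gamma sqrt n] the total drift is of order [q (s + eps^2 s^2) / n^2], which forces [q]
    up to the smaller of [n sqrt n / gamma] and [n / (eps^2 gamma^2)], up to constants; for
    [gamma < 1] the latter exceeds [n / (eps^2 sqrt gamma)]. For [gamma >= 1] the transcript bound
    is used, whatever the memory.

    The factor 18 gives a planted shift of [18 eps n^2 / 8 = 9/4 eps n^2], a little more than the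
    required gap [2 eps n^2], while [18 eps < 1] keeps the density positive. *)

Definition av (T : finType) (f : T -> R) : R := (\sum_t f t) / #|T|%:R.

Lemma eq_av T (f g : T -> R) : f =1 g -> av f = av g.
Proof. by move=> fg; rewrite /av; congr (_ / _); apply: eq_bigr. Qed.

Lemma avD T (f g : T -> R) : av (fun t => f t + g t) = av f + av g.
Proof. by rewrite /av big_split mulrDl. Qed.

Lemma avZ T (c : R) (f : T -> R) : av (fun t => c * f t) = c * av f.
Proof. by rewrite /av -mulr_sumr mulrA. Qed.

Lemma avZr T (c : R) (f : T -> R) : av (fun t => f t * c) = av f * c.
Proof. by rewrite /av -mulr_suml mulrAC. Qed.

Lemma avN T (f : T -> R) : av (fun t => - f t) = - av f.
Proof. by rewrite /av sumrN mulNr. Qed.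

Lemma avB T (f g : T -> R) : av (fun t => f t - g t) = av f - av g.
Proof. by rewrite avD avN. Qed.

Lemma av_sum T (J : Type) (r : seq J) (P : pred J) (f : J -> T -> R) :
  av (fun t => \sum_(j <- r | P j) f j t) = \sum_(j <- r | P j) av (f j).
Proof. by rewrite /av exchange_big mulr_suml. Qed.

Lemma av_exchange T U (f : T -> U -> R) :
  av (fun t => av (f t)) = av (fun u => av (fun t => f t u)).
Proof.
rewrite /av -!mulr_suml -!mulrA [in RHS]exchange_big; congr (_ * _).
exact: mulrC.
Qed.

Lemma le_av T (f g : T -> R) : (forall t, f t <= g t) -> av f <= av g.
Proof.
by move=> fg; rewrite ler_wpM2r ?invr_ge0 ?ler0n// ler_sum// => t _.
Qed.

Lemma av_ge0 T (f : T -> R) : (forall t, 0 <= f t) -> 0 <= av f.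
Proof. by move=> f0; rewrite divr_ge0 ?ler0n// sumr_ge0. Qed.

Lemma av_cst T (c : R) : (0 < #|T|)%N -> av (fun _ : T => c) = c.
Proof.
move=> T0; rewrite /av sumr_const -[c *+ _]mulr_natr mulfK//.
by rewrite pnatr_eq0 -lt0n.
Qed.

Lemma av_bij T (h : T -> T) (f : T -> R) : bijective h ->
  av (fun t => f (h t)) = av f.
Proof.
move=> hb; rewrite /av [in RHS](reindex h)//.
exact: onW_bij.
Qed.

Lemma sqr_av_le T (f : T -> R) : (0 < #|T|)%N ->
  av f ^+ 2 <= av (fun t => f t ^+ 2).
Proof.
move=> T0; rewrite -subr_ge0.
have -> : av (fun t => f t ^+ 2) - av f ^+ 2 =
    av (fun t => (f t - av f) ^+ 2).
  rewrite [in RHS](@eq_av _ _ (fun t => f t ^+ 2 - (2 * av f) * f t + av f ^+ 2));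
    last by move=> t; ring.
  by rewrite avD avB avZ av_cst//; ring.
by apply: av_ge0 => t; exact: sqr_ge0.
Qed.

Lemma av_tuple0 T (F : 0.-tuple T -> R) : av F = F [tuple].
Proof.
have c1 : #|{: 0.-tuple T}| = 1%N by rewrite card_tuple expn0.
rewrite (@eq_av _ _ (fun=> F [tuple])); last by move=> t; rewrite tuple0.
by rewrite av_cst// c1.
Qed.

Lemma av_tupleS T k (F : k.+1.-tuple T -> R) :
  av F = av (fun e => av (fun es : k.-tuple T => F [tuple of e :: es])).
Proof.
rewrite /av -mulr_suml -mulrA; congr (_ * _); last first.
  rewrite !card_tuple expnS natrM; have [->|T0] := eqVneq (#|T|%:R : R) 0.
    by rewrite mul0r !(invr0, mulr0).
  have [->|Tk] := eqVneq ((#|T| ^ k)%N%:R : R) 0.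
    by rewrite mulr0 !(invr0, mul0r).
  by rewrite invfM mulrC.
rewrite pair_big /= (reindex (fun p : T * k.-tuple T => [tuple of p.1 :: p.2]))//=.
exists (fun t : k.+1.-tuple T => (thead t, [tuple of behead t])).
  by case=> e es _ /=; congr (_, _); apply: val_inj.
by move=> t _; rewrite -tuple_eta.
Qed.

End Average.

Section Signs.
Variables (R : realFieldType) (I : finType).
Implicit Types (A B X Y : {set I}) (i : I).

Definition spin X i : R := if i \in X then 1 else -1.

Definition flip i X : {set I} := [set j | (j \in X) != (j == i)]%SET.

Lemma flipK i : involutive (flip i).
Proof.
by move=> X; apply/setP => j; rewrite !inE; case: (j \in X); case: (j == i).
Qed.

Lemma spin_flip i X : spin (flip i X) i = - spin X i.
Proof. by rewrite /spin inE eqxx; case: (i \in X); rewrite //= opprK. Qed.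

Lemma spin_flip_neq i j X : j != i -> spin (flip i X) j = spin X j.
Proof. by rewrite /spin inE => /negbTE ->; case: (j \in X). Qed.

Lemma spin_mulxx X i : spin X i * spin X i = 1.
Proof. by rewrite /spin; case: ifP; rewrite ?mulr1// mulrNN mulr1. Qed.

Lemma sqr_spin X i : spin X i ^+ 2 = 1. Proof. by rewrite expr2 spin_mulxx. Qed.

Lemma norm_spin X i : `|spin X i| = 1.
Proof. by rewrite /spin; case: ifP; rewrite ?normrN normr1. Qed.

(** The complement of the symmetric difference: since members have sign 1, this is the set whose
    signs are the products of those of [X] and [Y]. *)
Definition symdiff X Y : {set I} := [set i | (i \in X) == (i \in Y)]%SET.

Lemma spin_symdiff X Y i : spin (symdiff X Y) i = spin X i * spin Y i.
Proof.
by rewrite /spin inE; case: (i \in X); case: (i \in Y);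
  rewrite ?(mulrNN, mul1r, mulr1).
Qed.

Lemma symdiffK X : involutive (symdiff X).
Proof.
by move=> Y; apply/setP => j; rewrite !inE; case: (j \in X); case: (j \in Y).
Qed.

Lemma card_sets_gt0 : (0 < #|{set I}|)%N.
Proof. by apply/card_gt0P; exists finset.set0. Qed.

Lemma av_flip i (F : {set I} -> R) : av (fun X => F (flip i X)) = av F.
Proof. by apply: av_bij; exact: inv_bij (flipK i). Qed.

Lemma av_odd i (F : {set I} -> R) : (forall X, F (flip i X) = - F X) ->
  av F = 0.
Proof.
move=> Fodd; have : av F = - av F.
  by rewrite -{1}(av_flip i) -avN; apply: eq_av.
lra.
Qed.

(** Independence of the signs: the term [c i * spin X i] is odd under [flip i] while all else is
    invariant, so the factors drop out one at a time. *)
Lemma av_prod1 (s : seq I) (c : I -> R) (F : {set I} -> R) : uniq s ->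
  (forall i X, i \in s -> F (flip i X) = F X) ->
  av (fun X => F X * \prod_(i <- s) (1 + c i * spin X i)) = av F.
Proof.
elim: s F => [|i s IH] F /=.
  by move=> _ _; apply: eq_av => X; rewrite big_nil mulr1.
move=> /andP[nis us] Finv.
have inv0 j X : j \in s -> F (flip j X) = F X.
  by move=> js; apply: Finv; rewrite inE js orbT.
rewrite -(IH F us inv0).
apply/eqP; rewrite -subr_eq0 -avB; apply/eqP; apply: (@av_odd i) => X.
rewrite !big_cons spin_flip Finv ?mem_head//.
rewrite (@eq_big_seq _ _ _ _ s (fun j => 1 + c j * spin (flip i X) j)
  (fun j => 1 + c j * spin X j)); first by ring.
by move=> j js; rewrite spin_flip_neq//; apply: contraNneq nis => <-.
Qed.

(** The Walsh character of [A]. *)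
Definition chr (A X : {set I}) : R := \prod_(i in A) spin X i.

Lemma sqr_chr A X : chr A X ^+ 2 = 1.
Proof. by rewrite -prodrXl; apply: big1 => i _; rewrite sqr_spin. Qed.

Lemma chr_symdiff A X Y : chr A (symdiff X Y) = chr A X * chr A Y.
Proof. by rewrite -big_split; apply: eq_bigr => i _; rewrite spin_symdiff. Qed.

Lemma chr_flip A i X : i \in A -> chr A (flip i X) = - chr A X.
Proof.
move=> iA; rewrite /chr (bigD1 i)//= [in RHS](bigD1 i)//= spin_flip mulNr.
by congr (- (_ * _)); apply: eq_bigr => j /andP[_ ji]; rewrite spin_flip_neq.
Qed.

Lemma chrM A B X : chr A X * chr B X = chr (A :\: B :|: B :\: A) X.
Proof.
rewrite /chr big_mkcond [X in _ * X]big_mkcond -big_split [RHS]big_mkcond /=.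
apply: eq_bigr => i _; rewrite !inE.
by case: (i \in A); case: (i \in B); rewrite /= ?spin_mulxx ?mulr1 ?mul1r.
Qed.

Lemma av_chr A : A != finset.set0 -> av (chr A) = 0.
Proof. by case/finset.set0Pn => i iA; apply: (@av_odd i) => X; exact: chr_flip. Qed.

Lemma av_chr_ge0 A : 0 <= av (chr A).
Proof.
have [->|/av_chr ->//] := eqVneq A finset.set0.
by apply: av_ge0 => X; rewrite /chr finset.big_set0.
Qed.

End Signs.

(** * Exponential moments of quadratic forms *)

Section ExponentialBounds.
Variable R : realType.

Lemma expR_le_1Dx (y : R) : `|y| <= 2^-1 -> expR (y - 2 * y ^+ 2) <= 1 + y.
Proof.
rewrite ler_norml => /andP[y1 y2].
have h : 1 <= (1 + y) * expR (2 * y ^+ 2 - y).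
  apply: (@le_trans _ _ ((1 + y) * (1 + (2 * y ^+ 2 - y)))).
    have -> : (1 + y) * (1 + (2 * y ^+ 2 - y)) = 1 + y ^+ 2 * (1 + 2 * y).
      by ring.
    by rewrite lerDl mulr_ge0 ?sqr_ge0//; lra.
  by rewrite ler_wpM2l ?expR_ge1Dx//; lra.
have -> : y - 2 * y ^+ 2 = - (2 * y ^+ 2 - y) by ring.
by rewrite expRN -div1r ler_pdivrMr ?expR_gt0.
Qed.

(** For [|u| <= 1/2], add the bounds [exp y <= (1 + y) exp (2 y^2)] at [u] and [-u]; otherwise
    [|u| <= 2 u^2] bounds each exponential separately. *)
Lemma cosh_le (u : R) : (expR u + expR (- u)) / 2 <= expR (2 * u ^+ 2).
Proof.
have key (y : R) : `|y| <= 2^-1 -> expR y <= (1 + y) * expR (2 * y ^+ 2).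
  move=> /expR_le_1Dx h.
  rewrite -[in leLHS](subrK (2 * y ^+ 2) y) expRD.
  by rewrite ler_wpM2r ?expR_ge0.
have [ule|ugt] := leP `|u| 2^-1.
  have := key u ule; have := key (- u); rewrite normrN sqrrN => /(_ ule).
  set E := expR (2 * _); lra.
have un : 2 * u ^+ 2 = 2 * `|u| ^+ 2 by rewrite real_normK// num_real.
have le2 : `|u| <= 2 * u ^+ 2 by rewrite un; nra.
have h1 : expR u <= expR (2 * u ^+ 2).
  by rewrite ler_expR (le_trans _ le2)// ler_norm.
have h2 : expR (- u) <= expR (2 * u ^+ 2).
  by rewrite ler_expR (le_trans _ le2)// -normrN ler_norm.
lra.
Qed.

(** Jensen for the probability weights [h / p], from the tangent line of [exp] at the mean [c]. *)
Lemma expR_jensen (T : finType) (h F : T -> R) (p : R) :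
  (forall t, 0 <= h t) -> av h = p -> 0 < p ->
  p * expR (av (fun t => h t * F t) / p) <= av (fun t => h t * expR (F t)).
Proof.
move=> h0 hp p0; set c := _ / p.
have cE : av (fun t => h t * F t) = c * p by rewrite /c divfK// gt_eqF.
apply: (@le_trans _ _ (av (fun t => h t * (expR c * (1 + (F t - c)))))).
  rewrite (@eq_av _ _ _ (fun t => expR c * (1 - c) * h t +
    expR c * (h t * F t))); last by move=> t; ring.
  rewrite avD !avZ hp cE le_eqVlt; apply/orP; left; apply/eqP; ring.
apply: le_av => t; rewrite ler_wpM2l//.
have -> : expR (F t) = expR c * expR (F t - c) by rewrite -expRD; congr expR; ring.
by rewrite ler_wpM2l ?expR_ge0 ?expR_ge1Dx.
Qed.

End ExponentialBounds.

Section QuadraticForm.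
Variables (R : realType) (I : finType).
Implicit Types (s : seq I) (M : I -> I -> R) (b : I -> R).

Lemma sqr_sum_le s (f g : I -> R) :
  (\sum_(i <- s) f i * g i) ^+ 2 <=
  (\sum_(i <- s) f i ^+ 2) * (\sum_(i <- s) g i ^+ 2).
Proof.
elim: s => [|i s IH]; first by rewrite !big_nil expr0n /= mul0r.
rewrite !big_cons.
set F := \sum_(j <- s) f j ^+ 2 in IH *; set G := \sum_(j <- s) g j ^+ 2 in IH *.
set H := \sum_(j <- s) _ in IH *.
have F0 : 0 <= F by apply: sumr_ge0 => j _; exact: sqr_ge0.
have G0 : 0 <= G by apply: sumr_ge0 => j _; exact: sqr_ge0.
suff : 2 * (f i * g i) * H <= f i ^+ 2 * G + g i ^+ 2 * F by move: IH; nra.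
have h : (2 * (f i * g i) * H) ^+ 2 <= (f i ^+ 2 * G + g i ^+ 2 * F) ^+ 2.
  apply: (@le_trans _ _ (4 * (f i * g i) ^+ 2 * (F * G))).
    have -> : (2 * (f i * g i) * H) ^+ 2 = 4 * (f i * g i) ^+ 2 * H ^+ 2 by ring.
    by rewrite ler_wpM2l// mulr_ge0 ?sqr_ge0.
  rewrite -subr_ge0.
  have -> : (f i ^+ 2 * G + g i ^+ 2 * F) ^+ 2 - 4 * (f i * g i) ^+ 2 * (F * G)
    = (f i ^+ 2 * G - g i ^+ 2 * F) ^+ 2 by ring.
  exact: sqr_ge0.
have r0 : 0 <= f i ^+ 2 * G + g i ^+ 2 * F.
  by rewrite addr_ge0// mulr_ge0// sqr_ge0.
apply: (le_trans (ler_norm _)).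
by rewrite -(ger0_norm r0) -ler_sqr ?nnegrE ?normr_ge0// !real_normK ?num_real.
Qed.

Lemma quad_sqr_le s M b :
  (\sum_(i <- s) \sum_(j <- s) M i j * (b i * b j)) ^+ 2 <=
  (\sum_(i <- s) \sum_(j <- s) M i j ^+ 2) * (\sum_(i <- s) b i ^+ 2) ^+ 2.
Proof.
set B := \sum_(i <- s) b i ^+ 2.
have B0 : 0 <= B by apply: sumr_ge0 => i _; exact: sqr_ge0.
pose g i := \sum_(j <- s) M i j * b j.
have -> : \sum_(i <- s) \sum_(j <- s) M i j * (b i * b j) =
    \sum_(i <- s) b i * g i.
  by apply: eq_bigr => i _; rewrite mulr_sumr; apply: eq_bigr => j _; ring.
apply: (le_trans (sqr_sum_le _ _ _)).
rewrite -/B expr2 mulrA mulrC ler_wpM2r// mulr_suml ler_sum// => i _.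
exact: sqr_sum_le.
Qed.

Definition quad s M (X : {set I}) : R :=
  \sum_(i <- s) \sum_(j <- s) M i j * (spin R X i * spin R X j).

(* Averaging out one sign [x_k] replaces [M] by the rank-one update
   [M + 4 b b^T], where [b] is the row of [k], which lowers the allowed
   Frobenius norm by at least the increase [4 |b|^2] of the trace. *)
Lemma av_exp_quad s M (rho : R) : uniq s -> (forall i j, M i j = M j i) ->
  0 <= rho -> rho <= 8^-1 ->
  \sum_(i <- s) \sum_(j <- s) M i j ^+ 2 <= rho ^+ 2 ->
  av (fun X => expR (quad s M X / 2)) <= expR ((\sum_(i <- s) M i i + rho) / 2).
Proof.
elim: s M rho => [|k s IH] M rho /=.
  move=> _ _ rho0 _ _; rewrite (@eq_av _ _ _ (fun=> 1)); last first.
    by move=> X; rewrite /quad big_nil mul0r expR0.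
  rewrite av_cst ?card_sets_gt0// big_nil add0r.
  by rewrite -[leLHS]expR0 ler_expR divr_ge0.
move=> /andP[ks us] Msym rho0 rho8.
pose b i := M k i.
pose B := \sum_(i <- s) b i ^+ 2.
pose M' i j := M i j + 4 * (b i * b j).
have B0 : 0 <= B by apply: sumr_ge0 => i _; exact: sqr_ge0.
pose D := \sum_(i <- s) \sum_(j <- s) M i j ^+ 2.
have D0 : 0 <= D by do 2!apply: sumr_ge0 => ? _; exact: sqr_ge0.
have -> : \sum_(i <- k :: s) \sum_(j <- k :: s) M i j ^+ 2 =
    M k k ^+ 2 + 2 * B + D.
  rewrite big_cons big_cons -/B.
  under [X in _ + X = _]eq_bigr do rewrite big_cons.
  rewrite big_split /= -/D.
  rewrite (eq_bigr (fun i => b i ^+ 2)); last by move=> i _; rewrite /b Msym.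
  by rewrite -/B; ring.
move=> hD.
have hD2 : 2 * B + D <= rho ^+ 2.
  by apply: le_trans hD; rewrite -addrA lerDr sqr_ge0.
have Drho : D <= rho ^+ 2 by lra.
have Brho : 4 * B <= rho by nra.
pose Q := \sum_(i <- s) \sum_(j <- s) M i j * (b i * b j).
have hQ : Q <= rho * B.
  apply: (le_trans (ler_norm _)); rewrite -(@ger0_norm _ (rho * B)) ?mulr_ge0//.
  rewrite -ler_sqr ?nnegrE ?normr_ge0// !real_normK ?num_real//.
  apply: (le_trans (quad_sqr_le _ _ _)); rewrite -/D -/B exprMn.
  by rewrite ler_wpM2r// sqr_ge0.
have M'F : \sum_(i <- s) \sum_(j <- s) M' i j ^+ 2 = D + 8 * Q + 16 * B ^+ 2.
  have -> : B ^+ 2 = \sum_(i <- s) \sum_(j <- s) (b i ^+ 2 * b j ^+ 2).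
    by rewrite expr2 mulr_suml; apply: eq_bigr => i _; rewrite mulr_sumr.
  rewrite /D /Q !mulr_sumr -!big_split /=; apply: eq_bigr => i _.
  rewrite !mulr_sumr -!big_split /=; apply: eq_bigr => j _.
  by rewrite /M'; ring.
have IH' := IH M' (rho - 4 * B) us.
have {IH'} h : av (fun X => expR (quad s M' X / 2)) <=
    expR ((\sum_(i <- s) M' i i + (rho - 4 * B)) / 2).
  apply: IH'.
  - by move=> i j; rewrite /M' Msym [b i * _]mulrC.
  - by lra.
  - by lra.
  (* With [Q <= rho B] and [D <= rho^2 - 2 B], the claim reduces to [16 rho B <= 2 B]: the origin of
     the condition [rho <= 1/8]. *)
  - by rewrite M'F; nra.
have tr : \sum_(i <- s) M' i i + (rho - 4 * B) = \sum_(i <- s) M i i + rho.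
  rewrite /M' big_split /= -mulr_sumr.
  have -> : \sum_(i <- s) b i * b i = B by apply: eq_bigr => i _; rewrite expr2.
  by ring.
rewrite tr in h.
pose l X := \sum_(i <- s) b i * spin R X i.
have quadE X : quad (k :: s) M X = M k k + 2 * spin R X k * l X + quad s M X.
  rewrite /quad big_cons big_cons spin_mulxx mulr1.
  under [X in _ + X = _]eq_bigr do rewrite big_cons.
  rewrite big_split /=.
  have -> : \sum_(j <- s) M k j * (spin R X k * spin R X j) = spin R X k * l X.
    by rewrite /l mulr_sumr; apply: eq_bigr => i _; rewrite /b; ring.
  have -> : \sum_(i <- s) M i k * (spin R X i * spin R X k) = spin R X k * l X.
    by rewrite /l mulr_sumr; apply: eq_bigr => i _; rewrite /b Msym; ring.
  by ring.
have quad'E X : quad s M' X = quad s M X + 4 * l X ^+ 2.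
  have -> : l X ^+ 2 = \sum_(i <- s) \sum_(j <- s)
      (b i * spin R X i) * (b j * spin R X j).
    by rewrite expr2 mulr_suml; apply: eq_bigr => i _; rewrite mulr_sumr.
  rewrite /quad mulr_sumr -big_split; apply: eq_bigr => i _ /=.
  rewrite mulr_sumr -big_split; apply: eq_bigr => j _ /=.
  by rewrite /M'; ring.
have sgs X i : i \in s -> spin R (flip k X) i = spin R X i.
  by move=> i_s; rewrite spin_flip_neq//; apply: contraNneq ks => <-.
have lflip X : l (flip k X) = l X.
  by apply: eq_big_seq => i i_s; rewrite sgs.
have quadflip X : quad s M (flip k X) = quad s M X.
  rewrite /quad; apply: eq_big_seq => i i_s; apply: eq_big_seq => j j_s.
  by rewrite !sgs.
pose F X := expR (quad (k :: s) M X / 2).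
(* Between [X] and [flip k X] only the cross term [y = x_k l X] changes sign, and
   [cosh y <= exp (2 y^2)] gives exactly half of the extra [4 l X ^+ 2] in [quad s M' X]. *)
have -> : av F = av (fun X => (F X + F (flip k X)) / 2).
  by rewrite avZr avD av_flip; lra.
apply: (@le_trans _ _ (av (fun X => expR (M k k / 2) * expR (quad s M' X / 2)))).
  apply: le_av => X; rewrite /F !quadE spin_flip lflip quadflip quad'E.
  set y := spin R X k * l X.
  have y2 : y ^+ 2 = l X ^+ 2 by rewrite exprMn sqr_spin mul1r.
  have -> : (M k k + 2 * spin R X k * l X + quad s M X) / 2 =
    (M k k / 2 + quad s M X / 2) + y by rewrite /y; field.
  have -> : (M k k + 2 * - spin R X k * l X + quad s M X) / 2 =
    (M k k / 2 + quad s M X / 2) + - y by rewrite /y; field.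
  have -> : (quad s M X + 4 * l X ^+ 2) / 2 = quad s M X / 2 + 2 * y ^+ 2.
    by rewrite y2; field.
  rewrite !expRD [leRHS]mulrA -mulrDr -[leLHS]mulrA ler_wpM2l ?cosh_le//.
rewrite avZ big_cons -addrA [in leRHS]mulrDl expRD.
by rewrite ler_wpM2l ?expR_ge0.
Qed.

End QuadraticForm.

(** * Planted cuts and the level inequality *)

Section Pairs.
Variables (R : realType) (n : nat).
Implicit Types (X : {set 'I_n}) (e : vpair n) (G : {set vpair n}).

Lemma vpairP e : exists u v : 'I_n, u != v /\ val e = [set u; v]%SET.
Proof.
by have /cards2P[u [v [uv eE]]] := valP e; exists u, v.
Qed.

Lemma sum_pairs (f : {set 'I_n} -> R) : (forall u, f [set u]%SET = 0) ->
  \sum_u \sum_v f [set u; v]%SET = 2 * \sum_(e : vpair n) f (val e).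
Proof.
move=> f1; rewrite pair_big /=.
have two e : \sum_(p : 'I_n * 'I_n | [set p.1; p.2]%SET == val e) f (val e)
    = 2 * f (val e).
  have [u [v [uv ->]]] := vpairP e.
  rewrite (bigD1 (u, v))//= (bigD1 (v, u)) /=; last first.
    by rewrite finset.setUC eqxx xpair_eqE (eq_sym v) (negbTE uv).
  rewrite big1 ?addr0; first by ring.
  move=> [a b] /= /andP[/andP[/eqP eab n1] n2].
  have ha : a \in [set u; v]%SET by rewrite -eab !inE eqxx.
  have hb : b \in [set u; v]%SET by rewrite -eab !inE eqxx orbT.
  have hu : u \in [set a; b]%SET by rewrite eab !inE eqxx.
  have hv : v \in [set a; b]%SET by rewrite eab !inE eqxx orbT.
  move: ha hb hu hv n1 n2; rewrite !inE !xpair_eqE.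
  case/orP => /eqP ->; case/orP => /eqP ->; rewrite ?eqxx ?orbb ?andbT//=.
    by rewrite (eq_sym v) (negbTE uv).
  by rewrite (negbTE uv).
rewrite mulr_sumr -(eq_bigr _ (fun e _ => two e)).
rewrite (exchange_big_dep predT)//=; apply: eq_bigr => -[u v] _ /=.
have [<-|uv] := eqVneq u v.
  rewrite finset.setUid f1 big1// => e /eqP eE.
  have : #|[set u]%SET| == 2%N by rewrite eE; exact: (valP e).
  by rewrite finset.cards1.
have c2 : #|[set u; v]%SET| == 2%N by rewrite cards2 uv.
rewrite (big_pred1 (exist _ [set u; v]%SET c2 : vpair n))//.
Qed.

Definition chi X e : R := chr R (val e) X.

Lemma sqr_chi X e : chi X e ^+ 2 = 1. Proof. exact: sqr_chr. Qed.

Lemma norm_chi X e : `|chi X e| = 1.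
Proof. by apply/eqP; rewrite -sqrp_eq1 ?normr_ge0// real_normK ?num_real// sqr_chi. Qed.

Lemma chr_pair X (u v : 'I_n) : u != v ->
  chr R [set u; v]%SET X = spin R X u * spin R X v.
Proof.
move=> uv; rewrite /chr finset.big_setU1 ?inE//= finset.big_set1.
by [].
Qed.

(** Extension by zero to all vertex sets: the matrix [ext b [set u; v]] then has zero diagonal, as
    [[set u; u]] is a singleton. *)
Let ext (b : vpair n -> R) (A : {set 'I_n}) : R :=
  if insub A is Some e then b e else 0.

Let ext_val b e : ext b (val e) = b e.
Proof. by rewrite /ext valK. Qed.

Let ext1 b u : ext b [set u]%SET = 0.
Proof. by rewrite /ext insubN// finset.cards1. Qed.

(** As [chi X e] is a product of two signs, twice the exponent is a quadratic form whose matrix is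
    symmetric, of trace zero and squared Frobenius norm [2 * \sum_e b e ^+ 2]. *)
Lemma av_exp_chi (b : vpair n -> R) (rho : R) :
  0 <= rho -> rho <= 8^-1 -> 2 * \sum_(e : vpair n) b e ^+ 2 <= rho ^+ 2 ->
  av (fun X => expR (\sum_(e : vpair n) b e * chi X e)) <= expR (rho / 2).
Proof.
move=> rho0 rho8 hb.
pose M (u v : 'I_n) := ext b [set u; v]%SET.
have quadE X : quad (index_enum 'I_n) M X = 2 * \sum_(e : vpair n) b e * chi X e.
  rewrite -(eq_bigr _ (fun e _ => congr1 (fun z => z * _) (ext_val b e))).
  rewrite -(@sum_pairs (fun A => ext b A * chr R A X)); last first.
    by move=> u; rewrite ext1 mul0r.
  apply: eq_bigr => u _; apply: eq_bigr => v _; rewrite /M.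
  have [<-|uv] := eqVneq u v; first by rewrite finset.setUid ext1 !mul0r.
  by rewrite chr_pair.
rewrite (@eq_av _ _ _ (fun X => expR (quad (index_enum 'I_n) M X / 2))); last first.
  by move=> X; rewrite quadE mulrAC divff ?mul1r// pnatr_eq0.
have := @av_exp_quad _ _ (index_enum 'I_n) M rho.
rewrite (@big1 _ _ _ _ _ _ (fun i => M i i)) ?add0r; last first.
  by move=> u _; rewrite /M finset.setUid ext1.
apply => //; first exact: index_enum_uniq.
  by move=> u v; rewrite /M finset.setUC.
rewrite (@sum_pairs (fun A => ext b A ^+ 2)); last by move=> u; rewrite ext1 expr0n.
by rewrite (eq_bigr _ (fun e _ => congr1 (fun z => z ^+ 2) (ext_val b e))).
Qed.

Lemma sum_spin_sqr X :
  (\sum_u spin R X u) ^+ 2 = n%:R + 2 * \sum_(e : vpair n) chi X e.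
Proof.
pose f (A : {set 'I_n}) : R := if #|A| == 2%N then chr R A X else 0.
have -> : \sum_(e : vpair n) chi X e = \sum_(e : vpair n) f (val e).
  by apply: eq_bigr => e _; rewrite /f (eqP (valP e)).
rewrite -sum_pairs; last by move=> u; rewrite /f finset.cards1.
have -> : n%:R = \sum_(u < n) \sum_(v < n) (if u == v then 1 else 0 : R).
  rewrite (eq_bigr (fun=> 1)) ?sumr_const ?card_ord// => u _.
  by rewrite -big_mkcond (big_pred1 u)// => v; rewrite eq_sym.
rewrite expr2 mulr_suml -big_split; apply: eq_bigr => u _ /=.
rewrite mulr_sumr -big_split; apply: eq_bigr => v _ /=; rewrite /f.
have [<-|uv] := eqVneq u v.
  by rewrite finset.setUid finset.cards1 addr0 spin_mulxx.
by rewrite finset.cards2 uv chr_pair// add0r.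
Qed.

(** [sum_spin_sqr] at the full vertex set, where every sign is 1. *)
Lemma card_vpair : 2 * #|vpair n|%:R = n%:R ^+ 2 - n%:R :> R.
Proof.
have := sum_spin_sqr [set: 'I_n]%SET.
rewrite (eq_bigr (fun=> 1)) ?sumr_const ?card_ord; last first.
  by move=> u _; rewrite /spin inE.
rewrite (eq_bigr (fun=> 1)) ?sumr_const; last first.
  by move=> e _; rewrite /chi /chr big1// => u _; rewrite /spin inE.
by move=> ->; ring.
Qed.


(** Density, relative to the uniform graph, of the graph planted at [X]: a pair is an edge with
    probability [(1 + beta * chi X e) / 2]. As [chi X e = -1] on separated pairs, a negative [beta]
    favours edges across the cut. *)
Definition lik (beta : R) X G : R :=
  \prod_(e : vpair n) (1 + beta * chi X e * spin R G e).

Definition lik_avg (beta : R) G : R := av (fun X => lik beta X G).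

Lemma av_lik beta X : av (lik beta X) = 1.
Proof.
have := @av_prod1 R _ (index_enum (vpair n)) (fun e => beta * chi X e)
  (fun=> 1) (index_enum_uniq _).
rewrite av_cst ?card_sets_gt0// => <-//.
by apply: eq_av => G; rewrite mul1r.
Qed.

Lemma av_lik_avg beta : av (lik_avg beta) = 1.
Proof.
rewrite /lik_avg av_exchange (@eq_av _ _ _ (fun=> 1)) ?av_cst ?card_sets_gt0//.
by move=> X; exact: av_lik.
Qed.

Lemma lik_avg0 G : lik_avg 0 G = 1.
Proof.
rewrite /lik_avg (@eq_av _ _ _ (fun=> 1)) ?av_cst ?card_sets_gt0// => X.
by rewrite /lik big1// => e _; rewrite !mul0r addr0.
Qed.

Lemma lik_ge0 beta X G : `|beta| <= 1 -> 0 <= lik beta X G.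
Proof.
move=> b1; apply: prodr_ge0 => e _.
have : `|beta * chi X e * spin R G e| <= 1 by rewrite !normrM norm_chi norm_spin !mulr1.
rewrite ler_norml => /andP[]; lra.
Qed.

Lemma lik_avg_ge0 beta G : `|beta| <= 1 -> 0 <= lik_avg beta G.
Proof. by move=> b1; apply: av_ge0 => X; exact: lik_ge0. Qed.

(** With [mu G] the probability of a memory state given [G], [wt] is the probability of that state
    under the planted mixture, and [tilt] is the conditional bias of the answer on [e], taken as 0
    for a state of probability 0. *)
Definition wt (beta : R) (mu : {set vpair n} -> R) : R :=
  av (fun G => lik_avg beta G * mu G).

Definition tilt (beta : R) (mu : {set vpair n} -> R) e : R :=
  wt beta (fun G => mu G * spin R G e) / wt beta mu.

(** * The level inequality for one memory state *)

Section Level.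
Variables (beta : R) (mu : {set vpair n} -> R).
Hypothesis beta1 : `|beta| <= 1.
Hypothesis mu01 : forall G, 0 <= mu G <= 1.

Let h G := lik_avg beta G * mu G.

Let h_ge0 G : 0 <= h G.
Proof. by have /andP[? _] := mu01 G; rewrite mulr_ge0 ?lik_avg_ge0. Qed.

Let h_le G : h G <= lik_avg beta G.
Proof. by have /andP[_ ?] := mu01 G; rewrite ler_piMr ?lik_avg_ge0. Qed.

Lemma wt_ge0 : 0 <= wt beta mu.
Proof. exact: av_ge0. Qed.

Lemma wt_le1 : wt beta mu <= 1.
Proof. by rewrite -(av_lik_avg beta); exact: le_av. Qed.

Hypothesis wt0 : 0 < wt beta mu.

Lemma wt_spin e :
  av (fun G => h G * spin R G e) = wt beta mu * tilt beta mu e.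
Proof.
rewrite /tilt mulrC divfK ?gt_eqF//.
by apply: eq_av => G; rewrite /h mulrA.
Qed.

Lemma tilt_le1 e : `|tilt beta mu e| <= 1.
Proof.
have H (s : R) : `|s| = 1 -> s * tilt beta mu e <= 1.
  move=> s1; rewrite -(ler_pM2l wt0) mulr1 mulrCA -wt_spin -avZ.
  apply: le_av => G; rewrite -/(h G) mulrCA ler_piMr//.
  by rewrite (le_trans (ler_norm _))// normrM s1 norm_spin mul1r.
rewrite ler_norml; apply/andP; split.
  by have := H (-1) (normrN1 _); lra.
by have := H 1 (normr1 _); lra.
Qed.

(** Jensen moves the conditional mean of [F] into an exponential. After bounding [mu] by 1, the
    average over graphs factorizes into terms [1 + beta lam a_e chi X e], and an exponential moment
    over [X] is left, with [rho = 1/8] in [av_exp_chi]. *)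
Lemma level_exp (lam : R) : 0 <= lam <= 4^-1 ->
  2 * (beta * lam) ^+ 2 * (\sum_(e : vpair n) tilt beta mu e ^+ 2) <= 64^-1 ->
  wt beta mu * expR (lam / 2 * \sum_(e : vpair n) tilt beta mu e ^+ 2)
    <= expR (16^-1).
Proof.
move=> /andP[lam0 lam4]; set a := tilt beta mu.
set A := \sum_(e : vpair n) a e ^+ 2 => hA.
have A0 : 0 <= A by apply: sumr_ge0 => e _; exact: sqr_ge0.
have aW G e : `|lam * a e * spin R G e| <= 4^-1.
  rewrite normrM normrM norm_spin mulr1 (ger0_norm lam0).
  by rewrite -[leRHS]mulr1 ler_pM//; exact: tilt_le1.
have bac X e : `|beta * chi X e * (lam * a e)| <= 4^-1.
  rewrite normrM -[leRHS]mul1r ler_pM//.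
    by rewrite normrM norm_chi mulr1.
  rewrite normrM (ger0_norm lam0).
  by rewrite -[leRHS]mulr1 ler_pM//; exact: tilt_le1.
(* The correction [- 2 y^2] for [y = lam a_e spin G e] makes [exp (F G)] at most the product of the
   [1 + y], whose average against [lik] is explicit. *)
pose F G := \sum_(e : vpair n) (lam * a e * spin R G e - 2 * lam ^+ 2 * a e ^+ 2).
have avF : av (fun G => h G * F G) = wt beta mu * ((lam - 2 * lam ^+ 2) * A).
  rewrite (@eq_av _ _ _ (fun G => \sum_(e : vpair n)
      (lam * a e * (h G * spin R G e) - 2 * lam ^+ 2 * a e ^+ 2 * h G))).
    rewrite av_sum /A !mulr_sumr; apply: eq_bigr => e _.
    rewrite avB !avZ wt_spin -/(a e) -[av h]/(wt beta mu); ring.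
  by move=> G; rewrite mulr_sumr; apply: eq_bigr => e _; ring.
have := @expR_jensen _ _ h F (wt beta mu) h_ge0 erefl wt0.
rewrite avF [_ * ((_ - _) * _)]mulrC mulfK ?gt_eqF// => J.
(* For [lam <= 1/4] the correction costs at most half: [lam - 2 lam^2 >= lam / 2]. *)
apply: (@le_trans _ _ (wt beta mu * expR ((lam - 2 * lam ^+ 2) * A))).
  by rewrite ler_wpM2l ?(ltW wt0)// ler_expR ler_wpM2r//; nra.
apply: (le_trans J).
apply: (@le_trans _ _ (av (fun G => av (fun X =>
    lik beta X G * \prod_(e : vpair n) (1 + lam * a e * spin R G e))))).
  apply: le_av => G; rewrite avZr -/(lik_avg beta G).
  rewrite ler_pM ?expR_ge0//.
  rewrite /F expR_sum; apply: ler_prod => e _; rewrite expR_ge0/=.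
  have -> : 2 * lam ^+ 2 * a e ^+ 2 = 2 * (lam * a e * spin R G e) ^+ 2.
    by rewrite [X in _ = _ * X]exprMn sqr_spin; ring.
  by apply: expR_le_1Dx; rewrite (le_trans (aW _ _))//; lra.
rewrite av_exchange.
apply: (@le_trans _ _ (av (fun X => expR (\sum_(e : vpair n) (beta * lam * a e) * chi X e)))).
  apply: le_av => X.
  have nz e : 1 + beta * chi X e * (lam * a e) != 0.
    have := bac X e; rewrite ler_norml => /andP[? ?].
    by apply: lt0r_neq0; lra.
  (* As [spin^2 = 1], the product of two factors [1 + x s] and [1 + y s] is [1 + x y] plus a term
     odd in the sign [s], which averages out. *)
  rewrite (@eq_av _ _ _ (fun G => (\prod_(e : vpair n) (1 + beta * chi X e * (lam * a e)))
    * (1 * \prod_(e : vpair n) (1 + (beta * chi X e + lam * a e) /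
         (1 + beta * chi X e * (lam * a e)) * spin R G e)))); last first.
    move=> G; rewrite /lik mul1r -!big_split; apply: eq_bigr => e _ /=.
    have s2 := sqr_spin R G e; have nze := nz e.
    rewrite [RHS]mulrDr mulr1 [X in _ = _ + X]mulrA [X in _ = _ + X * _]mulrCA divff// mulr1.
    rewrite mulrDl mul1r mulrDr mulr1.
    rewrite [X in _ + X]addrC.
    have -> : beta * chi X e * spin R G e * (lam * a e * spin R G e) =
      beta * chi X e * (lam * a e) * spin R G e ^+ 2 by ring.
    by rewrite s2; ring.
  rewrite avZ (@av_prod1 _ _ (index_enum (vpair n)) _ (fun=> 1))//; last first.
    exact: index_enum_uniq.
  rewrite av_cst ?card_sets_gt0// mulr1 expR_sum; apply: ler_prod => e _.
  have := bac X e; rewrite ler_norml => /andP[b1 b2].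
  have -> : beta * lam * a e * chi X e = beta * chi X e * (lam * a e) by ring.
  by apply/andP; split; [lra|exact: expR_ge1Dx].
have -> : 16^-1 = 8^-1 / 2 :> R by lra.
apply: av_exp_chi => //.
rewrite (eq_bigr (fun e => (beta * lam) ^+ 2 * a e ^+ 2)); last by move=> e _; ring.
by rewrite -mulr_sumr mulrA (le_trans hA)//; lra.
Qed.

(** [L] is the self-information of the state. Logarithms in [level_exp] give
    [A <= (2 / lam) (L + 1/16)], and the admissible [lam] are of order up to
    [min (1, (beta^2 A)^(-1/2))]; hence a linear and a quadratic term in [L]. *)
Lemma level_le (L : R) : L = - ln (wt beta mu) ->
  \sum_(e : vpair n) tilt beta mu e ^+ 2 <=
    8 * (L + 1) + 576 * beta ^+ 2 * (L + 1) ^+ 2.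
Proof.
move=> LE; set A := \sum_(e : vpair n) _.
have A0 : 0 <= A by apply: sumr_ge0 => e _; exact: sqr_ge0.
have L0 : 0 <= L by rewrite LE oppr_ge0 ln_le0// wt_le1.
have key (lam : R) : 0 <= lam <= 4^-1 -> 2 * (beta * lam) ^+ 2 * A <= 64^-1 ->
    lam / 2 * A <= L + 16^-1.
  move=> h1 h2; have := level_exp h1 h2; rewrite -/A.
  rewrite -{1}[wt beta mu](lnK _) ?posrE// -expRD ler_expR LE; lra.
have B0 : 0 <= beta ^+ 2 * (L + 1) ^+ 2 by rewrite mulr_ge0 ?sqr_ge0.
(* In the first case the largest value [lam = 1/4] is admissible:
   [2 (beta / 4)^2 A <= 1/72 <= 1/64]. *)
have [small|big] := leP (beta ^+ 2 * A) 9^-1.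
  have := key 4^-1; rewrite exprMn => k.
  have : 4^-1 / 2 * A <= L + 16^-1 by apply: k; [lra|nra].
  nra.
set r := Num.sqrt (beta ^+ 2 * A).
have r2 : r ^+ 2 = beta ^+ 2 * A by rewrite sqr_sqrtr//; lra.
have r3 : 3^-1 < r.
  have r0 : 0 <= r by exact: sqrtr_ge0.
  by nra.
(* This [lam] makes the second condition read [1/72 <= 1/64]; it is at most [1/4] because
   [r > 1/3]. *)
have := key (12 * r)^-1; rewrite exprMn exprVn exprMn r2.
have bA : beta ^+ 2 * A != 0 by apply: lt0r_neq0; lra.
have /andP[b0 An0] : (beta != 0) && (A != 0).
  by move: bA; rewrite mulf_eq0 negb_or expf_eq0.
have -> : 2 * (beta ^+ 2 * (12 ^+ 2 * (beta ^+ 2 * A))^-1) * A = 72^-1.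
  by field; rewrite b0 An0.
have r12 : 0 < 12 * r by lra.
move=> /(_ _ _) k.
have {}k : (12 * r)^-1 / 2 * A <= L + 16^-1.
  apply: k; last by lra.
  by rewrite invr_ge0 ltW//= lef_pV2 ?posrE//; lra.
have A1 : A <= 24 * r * (L + 1).
  have -> : A = 24 * r * ((12 * r)^-1 / 2 * A) by field; lra.
  by rewrite ler_wpM2l//; lra.
have A2 : A ^+ 2 <= 576 * (beta ^+ 2 * A) * (L + 1) ^+ 2.
  rewrite -r2; have -> : 576 * r ^+ 2 * (L + 1) ^+ 2 = (24 * r * (L + 1)) ^+ 2 by ring.
  by rewrite ler_sqr ?nnegrE//; nra.
have Apos : 0 < A by rewrite lt_neqAle A0 andbT; apply: contraNneq bA => <-; rewrite mulr0.
have : A * A <= A * (576 * beta ^+ 2 * (L + 1) ^+ 2) by move: A2; rewrite expr2; lra.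
rewrite ler_pM2l//; lra.
Qed.

End Level.

End Pairs.

(** * Programs with bounded memory *)

Section Entropy.
Variable R : realType.

Lemma ln_sqr_le (y : R) : 1 <= y -> ln y ^+ 2 <= 4 * y.
Proof.
move=> y1; set r := Num.sqrt y.
have y0 : 0 <= y by lra.
have r2 : r ^+ 2 = y by rewrite sqr_sqrtr.
have r1 : 0 < r by rewrite sqrtr_gt0; lra.
have lnE : ln y = 2 * ln r by rewrite -r2 lnXn// mulr2n; ring.
have := ln_sublinear r1; have : 0 <= ln y by rewrite ln_ge0.
by rewrite lnE -r2; nra.
Qed.

(** Entropy is at most [ln K], in a form that can be summed term by term over [K] states: with
    [y = 1 / (p K)] one has [- ln p = ln K + ln y], [ln y <= y] and [p y = K^-1]. The square uses
    [ln y ^+ 2 <= 4 y], or [ln y <= 0] when [y < 1]. *)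
Lemma mul_ln_le (p K : R) : 0 < p -> p <= 1 -> 1 <= K ->
  p * (- ln p + 1) <= p * (ln K + 1) + K^-1 /\
  p * (- ln p + 1) ^+ 2 <= 2 * p * (ln K + 1) ^+ 2 + 8 * K^-1.
Proof.
move=> p0 p1 K1; have K0 : 0 < K by lra.
set y := (p * K)^-1.
have y0 : 0 < y by rewrite invr_gt0 mulr_gt0.
have py : p * y = K^-1 by rewrite /y; field; rewrite !gt_eqF.
have lnE : - ln p = ln K + ln y.
  by rewrite /y lnV ?posrE ?mulr_gt0// lnM ?posrE//; ring.
have l1 : ln y <= y by apply: ltW; exact: ln_sublinear.
have lnp : 0 <= - ln p by rewrite oppr_ge0 ln_le0.
have lK : 0 <= ln K by rewrite ln_ge0.
split.
  rewrite lnE -py -mulrDr ler_wpM2l ?(ltW p0)//; lra.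
have [y1|y1] := leP 1 y.
  have := ln_sqr_le y1; rewrite -py lnE => h.
  have -> : 2 * p * (ln K + 1) ^+ 2 + 8 * (p * y) =
    p * (2 * (ln K + 1) ^+ 2 + 8 * y) by ring.
  rewrite ler_wpM2l ?(ltW p0)//.
  have := sqr_ge0 (ln K + 1 - ln y); nra.
have ly : ln y <= 0 by rewrite ln_le0// ltW.
have K'0 : 0 <= K^-1 by rewrite invr_ge0 ltW.
apply: (@le_trans _ _ (p * (ln K + 1) ^+ 2)).
  by rewrite ler_wpM2l ?(ltW p0)// ler_sqr ?nnegrE; lra.
have : 0 <= p * (ln K + 1) ^+ 2 by rewrite mulr_ge0 ?sqr_ge0 ?ltW.
lra.
Qed.

End Entropy.

(** * Evolution of the memory state and the potential argument *)

Section Memory.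
Variables (R : realType) (n : nat).
Implicit Types (G : {set vpair n}) (e : vpair n).

(** When [wt] vanishes, so does its nonnegative integrand at every graph, and both sides are 0. *)
Lemma wt_tilt beta (mu : {set vpair n} -> R) e : `|beta| <= 1 ->
  (forall G, 0 <= mu G <= 1) ->
  wt beta (fun G => mu G * spin R G e) = wt beta mu * tilt beta mu e.
Proof.
move=> b1 mu01; rewrite /tilt mulrC.
have [w0|w0] := eqVneq (wt beta mu) 0; last by rewrite divfK.
have h0 G : lik_avg beta G * mu G = 0.
  have := w0; rewrite /wt /av => /eqP; rewrite mulf_eq0 invr_eq0 pnatr_eq0.
  rewrite [X in _ || X]eqn0Ngt card_sets_gt0 orbF psumr_eq0.
    by move=> /allP /(_ G); rewrite mem_index_enum => /(_ isT) /eqP.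
  by move=> G' _; have /andP[? _] := mu01 G'; rewrite mulr_ge0 ?lik_avg_ge0.
rewrite w0 mulr0 /wt (@eq_av _ _ _ (fun=> 0)) ?av_cst ?card_sets_gt0//.
by move=> G; rewrite mulrA h0 mul0r.
Qed.

Definition level_bound (beta K : R) : R :=
  8 * (ln K + 2) + 576 * beta ^+ 2 * (2 * (ln K + 1) ^+ 2 + 8).

(** Averages [level_le] over the states; [mul_ln_le] bounds the mean of the self-information and of
    its square by [ln #|S|] and its square, up to constants. *)
Lemma level_sum (S : finType) beta (mu : S -> {set vpair n} -> R) :
  `|beta| <= 1 -> (forall m G, 0 <= mu m G) ->
  (forall G, \sum_m mu m G = 1) ->
  \sum_m wt beta (mu m) * (\sum_e tilt beta (mu m) e ^+ 2) <=
  level_bound beta #|S|%:R.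
Proof.
move=> b1 mu0 mu1.
have mu01 m G : 0 <= mu m G <= 1.
  by rewrite mu0 -(mu1 G) (bigD1 m)//= lerDl sumr_ge0.
have sumwt : \sum_m wt beta (mu m) = 1.
  rewrite -[LHS](av_sum (index_enum S) predT (fun m G => lik_avg beta G * mu m G)).
  rewrite -(av_lik_avg n beta); apply: eq_av => G.
  by rewrite -mulr_sumr mu1 mulr1.
have S0 : (0 < #|S|)%N.
  rewrite lt0n; apply/eqP => S0.
  move: sumwt; rewrite big1 => [/eqP|m _]; first by rewrite eq_sym oner_eq0.
  by have := card0_eq S0 m.
have [K KE] : exists K : R, K = #|S|%:R by exists #|S|%:R.
have K1 : 1 <= K by rewrite KE ler1n.
rewrite -KE.
set Z := ln K + 1.
apply: (@le_trans _ _ (\sum_m (8 * (wt beta (mu m) * Z + K^-1) +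
    576 * beta ^+ 2 * (2 * wt beta (mu m) * Z ^+ 2 + 8 * K^-1)))).
  apply: ler_sum => m _.
  have K'0 : 0 <= K^-1 by rewrite invr_ge0; lra.
  have b20 : 0 <= 576 * beta ^+ 2 by have := sqr_ge0 beta; lra.
  have := wt_ge0 b1 (mu01 m); rewrite le_eqVlt => /orP[/eqP <-|w0].
    have hK : 0 <= 8 * K^-1 by rewrite mulr_ge0.
    by rewrite !(mul0r, mulr0, add0r); exact: (addr_ge0 hK (mulr_ge0 b20 hK)).
  have [h1 h2] := mul_ln_le w0 (wt_le1 b1 (mu01 m)) K1.
  apply: (@le_trans _ _ (wt beta (mu m) * (8 * (- ln (wt beta (mu m)) + 1) +
      576 * beta ^+ 2 * (- ln (wt beta (mu m)) + 1) ^+ 2))).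
    by rewrite ler_pM2l//; exact: level_le.
  rewrite mulrDr; apply: lerD; first by rewrite mulrCA ler_wpM2l.
  by rewrite mulrCA ler_wpM2l.
have cardK : \sum_(m : S) K^-1 = 1.
  by rewrite sumr_const -[K^-1 *+ _]mulr_natr -KE mulVf// gt_eqF//; lra.
rewrite (eq_bigr (fun m => (8 * Z + 1152 * beta ^+ 2 * Z ^+ 2) * wt beta (mu m) +
    (8 + 4608 * beta ^+ 2) * K^-1)); last by move=> m _; ring.
rewrite big_split /= -[X in X + _]mulr_sumr -[X in _ + X]mulr_sumr sumwt cardK.
by rewrite /level_bound /Z le_eqVlt; apply/orP; left; apply/eqP; ring.
Qed.

Variables (S : finType) (st : nat -> S -> vpair n * bool -> S) (m0 : S).

(** The probability, over the queried pairs only, of state [m] after [t] queries to the fixed graph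
    [G]. As a function of [G] it is the weight [mu] to which the level inequality is applied. *)
Fixpoint occ t G (m : S) : R :=
  if t is t'.+1 then
    \sum_m' occ t' G m' * av (fun e => (st t' m' (e, e \in G) == m)%:R)
  else (m == m0)%:R.

Lemma occ_ge0 t G m : 0 <= occ t G m.
Proof.
elim: t m => [|t IH] m //=.
by apply: sumr_ge0 => m' _; rewrite mulr_ge0//; apply: av_ge0.
Qed.

Lemma occ_step t G (f : S -> R) : \sum_m occ t.+1 G m * f m =
  \sum_m occ t G m * av (fun e => f (st t m (e, e \in G))).
Proof.
rewrite /= (eq_bigr _ (fun m _ => mulr_suml _ _ _ _)) exchange_big /=.
apply: eq_bigr => m _.
rewrite (eq_bigr (fun m' => occ t G m * av (fun e =>
  (st t m (e, e \in G) == m')%:R * f m'))); last first.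
  by move=> m' _; rewrite -mulrA -avZr.
rewrite -mulr_sumr -av_sum; congr (_ * _); apply: eq_av => e.
rewrite (bigD1 (st t m (e, e \in G)))//= eqxx mul1r big1 ?addr0//.
by move=> m' /negbTE; rewrite eq_sym => ->; rewrite mul0r.
Qed.

Hypothesis n_pairs : (0 < #|vpair n|)%N.

Lemma sum_occ t G : \sum_m occ t G m = 1.
Proof.
elim: t => [|t IH].
  by rewrite (bigD1 m0)//= eqxx big1 ?addr0// => m /negbTE ->.
rewrite (eq_bigr _ (fun m _ => esym (mulr1 _))) occ_step -[RHS]IH.
by apply: eq_bigr => m _; rewrite av_cst// mulr1.
Qed.

Lemma occ_le1 t G m : 0 <= occ t G m <= 1.
Proof.
by rewrite occ_ge0 -(sum_occ t G) (bigD1 m)//= lerDl sumr_ge0// => *; exact: occ_ge0.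
Qed.

Fixpoint prog t m (xs : seq (vpair n * bool)) : S :=
  if xs is x :: xs' then prog t.+1 (st t m x) xs' else m.

Lemma occ_prog k t G (f : S -> R) :
  \sum_m occ t G m * av (fun es : k.-tuple (vpair n) =>
      f (prog t m [seq (e, e \in G) | e <- es])) =
  \sum_m occ (t + k) G m * f m.
Proof.
elim: k t => [|k IH] t.
  by rewrite addn0; apply: eq_bigr => m _; rewrite av_tuple0.
rewrite addnS -addSn -IH occ_step; apply: eq_bigr => m _; congr (_ * _).
by rewrite av_tupleS.
Qed.

Lemma occ_run q G (f : S -> R) :
  av (fun es : q.-tuple (vpair n) =>
      f (prog 0 m0 [seq (e, e \in G) | e <- es])) = \sum_m occ q G m * f m.
Proof.
rewrite -[q in RHS]add0n -(occ_prog _ 0) (bigD1 m0)//= eqxx mul1r.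
by rewrite big1 ?addr0// => m /negbTE ->; rewrite mul0r.
Qed.

(* The acceptance probability when the remaining [k] queries are answered by
   fresh unbiased bits. *)
Fixpoint fresh (acc : S -> R) k t m : R :=
  if k is k'.+1 then
    av (fun e => (fresh acc k' t.+1 (st t m (e, true)) +
                  fresh acc k' t.+1 (st t m (e, false))) / 2)
  else acc m.

Lemma fresh01 acc k t m : (forall m, 0 <= acc m <= 1) ->
  0 <= fresh acc k t m <= 1.
Proof.
move=> acc01; elim: k t m => [|k IH] t m //=; apply/andP; split.
  apply: av_ge0 => e.
  have /andP[? _] := IH t.+1 (st t m (e, true)).
  have /andP[? _] := IH t.+1 (st t m (e, false)); lra.
rewrite -[leRHS](@av_cst _ (vpair n))//; apply: le_av => e.
have /andP[_ ?] := IH t.+1 (st t m (e, true)).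
have /andP[_ ?] := IH t.+1 (st t m (e, false)); lra.
Qed.

(** Makes the reference values cancel when acceptance is bounded under one distribution and
    rejection under the other. *)
Lemma freshC acc k t m : fresh (fun m => 1 - acc m) k t m = 1 - fresh acc k t m.
Proof.
elim: k t m => [|k IH] t m //=.
apply/eqP; rewrite eq_sym subr_eq -avD (@eq_av _ _ _ (fun=> 1)) ?av_cst// => e.
by rewrite !IH; field.
Qed.

Section Potential.
Variables (beta lam : R) (acc : S -> R).
Hypothesis beta1 : `|beta| <= 1.
Hypothesis lam0 : 0 < lam.
Hypothesis lam1 : lam <= 1.
Hypothesis acc01 : forall m, 0 <= acc m <= 1.

Let p t m := wt beta (fun G => occ t G m).
Let a t m e := tilt beta (fun G => occ t G m) e.

(** A true step is a step with an unbiased answer, plus the conditional bias times half the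
    difference of the two outcomes. *)
Lemma sum_wt_step t (f : S -> R) : \sum_m p t.+1 m * f m =
  \sum_m p t m * av (fun e => (f (st t m (e, true)) + f (st t m (e, false))) / 2
    + a t m e * ((f (st t m (e, true)) - f (st t m (e, false))) / 2)).
Proof.
pose A m e := (f (st t m (e, true)) + f (st t m (e, false))) / 2.
pose B m e := (f (st t m (e, true)) - f (st t m (e, false))) / 2.
transitivity (av (fun G => lik_avg beta G * \sum_m occ t.+1 G m * f m)).
  rewrite (@eq_av _ _ _ (fun G => \sum_m lik_avg beta G * occ t.+1 G m * f m)).
    by rewrite av_sum; apply: eq_bigr => m _; rewrite avZr.
  by move=> G; rewrite mulr_sumr; apply: eq_bigr => m _; rewrite mulrA.
rewrite (@eq_av _ _ _ (fun G => \sum_m av (fun e => lik_avg beta G *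
    occ t G m * A m e + lik_avg beta G * (occ t G m * spin R G e) * B m e))).
  rewrite av_sum; apply: eq_bigr => m _.
  rewrite av_exchange -avZ; apply: eq_av => e.
  have ptE : av (fun G => lik_avg beta G * occ t G m) = p t m by [].
  have ptaE : av (fun G => lik_avg beta G * (occ t G m * spin R G e)) =
      p t m * a t m e by apply: wt_tilt => // G; exact: occ_le1.
  by rewrite avD !avZr ptE ptaE -/(A m e) -/(B m e); ring.
move=> G; rewrite occ_step mulr_sumr; apply: eq_bigr => m _.
rewrite mulrA -avZ; apply: eq_av => e.
have -> : f (st t m (e, e \in G)) = A m e + spin R G e * B m e.
  by rewrite /A /B /spin; case: (e \in G); field.
by ring.
Qed.

(** With [w] and [d] the half-sum and half-difference of the two successor values and [x] the bias,
    the step changes the potential by [x c d - lam d^2], where [c = 1 - 2 lam w] has [|c| <= 1].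
    This is at most [x^2 / (4 lam)], and [level_sum] bounds the mean of [x^2]. *)
Lemma potential_step k t :
  \sum_m p t.+1 m * (fresh acc k t.+1 m - lam * fresh acc k t.+1 m ^+ 2) <=
  \sum_m p t m * (fresh acc k.+1 t m - lam * fresh acc k.+1 t m ^+ 2) +
  level_bound beta #|S|%:R / (4 * lam * #|vpair n|%:R).
Proof.
rewrite sum_wt_step.
set D := level_bound _ _.
have N0 : (#|vpair n|%:R : R) != 0 by rewrite pnatr_eq0 -lt0n.
have sumA : \sum_m p t m * av (fun e => a t m e ^+ 2 / (4 * lam)) <=
    D / (4 * lam * #|vpair n|%:R).
  have -> : \sum_m p t m * av (fun e => a t m e ^+ 2 / (4 * lam)) =
      (\sum_m p t m * \sum_e a t m e ^+ 2) / (4 * lam * #|vpair n|%:R).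
    rewrite mulr_suml; apply: eq_bigr => m _; rewrite avZr /av.
    by field; rewrite N0 gt_eqF.
  rewrite ler_wpM2r ?invr_ge0 ?mulr_ge0 ?ler0n ?(ltW lam0)//.
  apply: level_sum => // [m G|G]; [exact: occ_ge0|exact: sum_occ].
apply: le_trans (lerD (lexx _) sumA); rewrite -big_split ler_sum// => m _.
rewrite -[leRHS]mulrDr ler_wpM2l//; first by apply: wt_ge0 => // G; exact: occ_le1.
rewrite [fresh acc k.+1 t m]/=.
set vp := fun e => fresh acc k t.+1 (st t m (e, true)).
set vm := fun e => fresh acc k t.+1 (st t m (e, false)).
pose w e := (vp e + vm e) / 2.
apply: (@le_trans _ _ (av (fun e => w e - lam * w e ^+ 2 + a t m e ^+ 2 / (4 * lam)))).
  apply: le_av => e.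
  have /andP[p0 p1] := fresh01 k t.+1 (st t m (e, true)) acc01.
  have /andP[q0 q1] := fresh01 k t.+1 (st t m (e, false)) acc01.
  rewrite -/(vp e) -/(vm e) in p0 p1 q0 q1 *.
  set d := (vp e - vm e) / 2; set x := a t m e.
  have -> : (vp e - lam * vp e ^+ 2 + (vm e - lam * vm e ^+ 2)) / 2 +
      x * ((vp e - lam * vp e ^+ 2 - (vm e - lam * vm e ^+ 2)) / 2) =
      w e - lam * w e ^+ 2 + (x * (1 - 2 * lam * w e) * d - lam * d ^+ 2).
    by rewrite /w /d; field.
  rewrite lerD2l; set c := 1 - 2 * lam * w e.
  have w01 : 0 <= w e <= 1 by rewrite /w; apply/andP; split; lra.
  have c2 : c ^+ 2 <= 1.
    move/andP: w01 => [w0 w1].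
    have z0 : 0 <= lam * w e by rewrite mulr_ge0// ltW.
    have z1 : lam * w e <= 1 by rewrite mulr_ile1// ltW.
    by rewrite /c -mulrA; move: (lam * w e) z0 z1 => z z0 z1; nra.
  apply: (@le_trans _ _ ((x * c) ^+ 2 / (4 * lam))).
    rewrite -subr_ge0.
    have -> : (x * c) ^+ 2 / (4 * lam) - (x * c * d - lam * d ^+ 2) =
      lam * ((x * c) / (2 * lam) - d) ^+ 2 by field; rewrite gt_eqF.
    by rewrite mulr_ge0 ?sqr_ge0// ltW.
  rewrite ler_wpM2r ?invr_ge0 ?mulr_ge0 ?(ltW lam0)//.
  by rewrite exprMn ler_piMr ?sqr_ge0.
(* Replacing [w e] by its mean over the queried pair can only increase the concave [- lam w^2]. *)
rewrite avD lerD2r avB avZ lerD2l lerN2 ler_wpM2l ?(ltW lam0)//.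
exact: sqr_av_le.
Qed.

(** The potential telescopes. Its term [- lam v^2] has the right sign at the start and costs at most
    [lam] at the end. *)
Lemma accept_le q :
  av (fun G => lik_avg beta G * av (fun es : q.-tuple (vpair n) =>
      acc (prog 0 m0 [seq (e, e \in G) | e <- es]))) <=
  fresh acc q 0 m0 + lam +
  q%:R * (level_bound beta #|S|%:R / (4 * lam * #|vpair n|%:R)).
Proof.
set D := level_bound _ _ / _.
have sump t : \sum_m p t m = 1.
  rewrite -[LHS](av_sum (index_enum S) predT
    (fun m G => lik_avg beta G * occ t G m)).
  rewrite -(av_lik_avg n beta); apply: eq_av => G.
  by rewrite -mulr_sumr sum_occ mulr1.
have p_ge0 t m : 0 <= p t m by apply: wt_ge0 => // G; exact: occ_le1.
have p0 m : p 0 m = (m == m0)%:R.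
  by rewrite /p /wt /= avZr av_lik_avg mul1r.
have run k t : \sum_m p (t + k) m * (acc m - lam * acc m ^+ 2) <=
    \sum_m p t m * (fresh acc k t m - lam * fresh acc k t m ^+ 2) + k%:R * D.
  elim: k t => [|k IH] t; first by rewrite addn0 mul0r addr0.
  rewrite addnS -addSn (le_trans (IH _))// -natr1 mulrDl mul1r [_ + D]addrC addrA.
  by rewrite lerD2r; exact: potential_step.
have sump0 f : \sum_m p 0 m * f m = f m0.
  rewrite (bigD1 m0)// [LHS]/= p0 eqxx mul1r big1 => [|m /negbTE mm]; first exact: addr0.
  by rewrite p0 mm mul0r.
have := run q 0; rewrite add0n sump0.
have -> : av (fun G => lik_avg beta G * av (fun es : q.-tuple (vpair n) =>
    acc (prog 0 m0 [seq (e, e \in G) | e <- es]))) = \sum_m p q m * acc m.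
  rewrite (@eq_av _ _ _ (fun G => \sum_m lik_avg beta G * occ q G m * acc m)).
    by rewrite av_sum; apply: eq_bigr => m _; rewrite avZr.
  by move=> G; rewrite occ_run mulr_sumr; apply: eq_bigr => m _; rewrite mulrA.
have : \sum_m p q m * acc m <= \sum_m p q m * (acc m - lam * acc m ^+ 2) + lam.
  have suml : \sum_m p q m * lam = lam by rewrite -mulr_suml sump mul1r.
  rewrite -[X in _ + X]suml -big_split; apply: ler_sum => m _.
  have E : p q m * acc m <= p q m * (acc m - lam * acc m ^+ 2) + p q m * lam.
    rewrite -mulrDr ler_wpM2l//; have /andP[a0 a1] := acc01 m.
    have : lam * acc m ^+ 2 <= lam by rewrite ler_piMr ?(ltW lam0)// exprn_ile1.
    lra.
  exact: E.
have : 0 <= lam * fresh acc q 0 m0 ^+ 2 by rewrite mulr_ge0 ?sqr_ge0// ltW.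
lra.
Qed.

End Potential.

(** [accept_le] for the verdict at bias [beta] and for its negation at bias 0; the two acceptance
    probabilities under fresh bits add up to 1. *)
Lemma memory_indistinguishable q (beta lam : R) (acc : S -> bool) :
  `|beta| <= 1 -> 0 < lam -> lam <= 1 ->
  av (fun G => lik_avg beta G * av (fun es : q.-tuple (vpair n) =>
      (acc (prog 0 m0 [seq (e, e \in G) | e <- es]))%:R)) +
  av (fun G => av (fun es : q.-tuple (vpair n) =>
      (~~ acc (prog 0 m0 [seq (e, e \in G) | e <- es]))%:R)) <=
  1 + 2 * lam + q%:R * ((level_bound beta #|S|%:R + level_bound 0 #|S|%:R) /
    (4 * lam * #|vpair n|%:R)).
Proof.
move=> b1 l0 l1.
have b01 (b : bool) : 0 <= (b%:R : R) <= 1 by case: b; rewrite ler01 lexx.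
have h1 := accept_le b1 l0 l1 (fun m => b01 (acc m)) q.
have n0 : `|0 : R| <= 1 by rewrite normr0.
have := accept_le n0 l0 l1 (fun m => b01 (~~ acc m)) q.
rewrite (@eq_av _ _ _ (fun G => av (fun es : q.-tuple (vpair n) =>
      (~~ acc (prog 0 m0 [seq (e, e \in G) | e <- es]))%:R))); last first.
  by move=> G; rewrite lik_avg0 mul1r.
have -> : fresh (fun m => (~~ acc m)%:R) q 0 m0 =
    1 - fresh (fun m => (acc m)%:R) q 0 m0.
  rewrite -freshC; congr fresh; apply/funext => m.
  by case: (acc m); rewrite ?subrr ?subr0.
lra.
Qed.

End Memory.

(** * Second moment of the likelihood ratio *)

Section SecondMoment.
Variables (R : realType) (n : nat).
Implicit Types (X Y Z : {set 'I_n}) (G : {set vpair n}) (e : vpair n).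
Implicit Types (s : seq (vpair n)).

Definition likS (beta : R) s X G : R :=
  \prod_(e <- s) (1 + beta * chi R X e * spin R G e).

Lemma av_likS beta s X : uniq s -> av (likS beta s X) = 1.
Proof.
move=> us; have := @av_prod1 R _ s (fun e => beta * chi R X e) (fun=> 1) us.
rewrite av_cst ?card_sets_gt0// => <-//.
by apply: eq_av => G; rewrite mul1r.
Qed.

(** [D] does not depend on the pairs outside [s], so their factors average to 1. *)
Lemma av_lik_restrict beta s X (D : {set vpair n} -> R) : uniq s ->
  (forall e G, e \notin s -> D (flip e G) = D G) ->
  av (fun G => lik beta X G * D G) = av (fun G => likS beta s X G * D G).
Proof.
move=> us Dinv; pose r := [seq e <- index_enum (vpair n) | e \notin s].
have ur : uniq r by rewrite filter_uniq// index_enum_uniq.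
rewrite -(@av_prod1 R _ r (fun e => beta * chi R X e)
  (fun G => likS beta s X G * D G) ur).
  apply: eq_av => G; rewrite mulrAC; congr (_ * _).
  rewrite /lik (bigID (mem s)) /r big_filter /=; congr (_ * _).
  rewrite -big_filter; apply: perm_big; apply: uniq_perm => //.
    by rewrite filter_uniq// index_enum_uniq.
  by move=> e; rewrite mem_filter mem_index_enum andbT.
move=> e G; rewrite mem_filter => /andP[es _]; rewrite Dinv//; congr (_ * _).
by apply: eq_big_seq => f fs; rewrite spin_flip_neq//; apply: contraNneq es => <-.
Qed.

Lemma av_likS_mul beta s X Y : uniq s -> `|beta| < 1 ->
  av (fun G => likS beta s X G * likS beta s Y G) =
  \prod_(e <- s) (1 + beta ^+ 2 * chi R (symdiff X Y) e).
Proof.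
move=> us b1.
have d1 : beta ^+ 2 < 1 by rewrite -real_normK ?num_real// exprn_ilt1.
have nz e : 1 + beta ^+ 2 * chi R (symdiff X Y) e != 0.
  have : `|beta ^+ 2 * chi R (symdiff X Y) e| < 1.
    by rewrite normrM norm_chi mulr1 ger0_norm ?sqr_ge0.
  by rewrite ltr_norml => /andP[? _]; apply: lt0r_neq0; lra.
rewrite (@eq_av _ _ _ (fun G => \prod_(e <- s) (1 + beta ^+ 2 * chi R (symdiff X Y) e)
   * (1 * \prod_(e <- s) (1 + beta * (chi R X e + chi R Y e) /
         (1 + beta ^+ 2 * chi R (symdiff X Y) e) * spin R G e)))).
  rewrite avZ (@av_prod1 _ _ s _ (fun=> 1))// av_cst ?card_sets_gt0// mulr1//.
move=> G; rewrite mul1r -!big_split; apply: eq_bigr => e _ /=.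
have s2 := sqr_spin R G e; have := nz e.
rewrite /chi chr_symdiff -/(chi R X e) -/(chi R Y e) => nze.
transitivity (1 + beta ^+ 2 * (chi R X e * chi R Y e) * spin R G e ^+ 2 +
  beta * (chi R X e + chi R Y e) * spin R G e); first by ring.
by rewrite s2; field.
Qed.

(** The square is a double average over independent cuts [X] and [Y], in which only [symdiff X Y]
    matters; for fixed [X] it is again uniform. *)
Lemma av_likS_avg_sqr beta s : uniq s -> `|beta| < 1 ->
  av (fun G => av (fun X => likS beta s X G) ^+ 2) =
  av (fun Z => \prod_(e <- s) (1 + beta ^+ 2 * chi R Z e)).
Proof.
move=> us b1.
rewrite (@eq_av _ _ _ (fun G => av (fun X => av (fun Y =>
    likS beta s X G * likS beta s Y G)))); last first.
  move=> G; rewrite expr2 -avZr; apply: eq_av => X; exact: esym (avZ _ _).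
rewrite av_exchange -[RHS](@av_cst _ {set 'I_n}) ?card_sets_gt0//.
apply: eq_av => X; rewrite av_exchange.
rewrite (@eq_av _ _ _ _ (fun Y => av_likS_mul X Y us b1)).
rewrite (@av_bij _ _ (symdiff X) (fun Z => \prod_(e <- s) (1 + beta ^+ 2 * chi R Z e)))//.
exact: inv_bij (symdiffK X).
Qed.

(** The induction needs every [A]: the factor of [e] adds to [chr A] the multiple by [d] of the
    character of the symmetric difference of [A] and [e]. *)
Lemma av_prod_chr_ge0 (d : R) s (A : {set 'I_n}) : 0 <= d ->
  0 <= av (fun Z => \prod_(e <- s) (1 + d * chi R Z e) * chr R A Z).
Proof.
move=> d0; elim: s A => [|e s IH] A.
  by under eq_av do rewrite big_nil mul1r; exact: av_chr_ge0.
rewrite (@eq_av _ _ _ (fun Z => \prod_(f <- s) (1 + d * chi R Z f) * chr R A Z +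
  d * (\prod_(f <- s) (1 + d * chi R Z f) *
    chr R (val e :\: A :|: A :\: val e)%SET Z))).
  by rewrite avD avZ addr_ge0// mulr_ge0.
by move=> Z; rewrite big_cons -chrM -/(chi R Z e); ring.
Qed.

(* All Fourier coefficients of the products are nonnegative, so that dropping
   the repeated factors can only decrease the average. *)
Lemma av_prod_undup (d : R) s t : 0 <= d ->
  av (fun Z => \prod_(e <- undup s ++ t) (1 + d * chi R Z e)) <=
  av (fun Z => \prod_(e <- s ++ t) (1 + d * chi R Z e)).
Proof.
move=> d0; elim: s t => [|e s IH] t //=.
have swap r : av (fun Z => \prod_(f <- r ++ e :: t) (1 + d * chi R Z f)) =
    av (fun Z => \prod_(f <- e :: r ++ t) (1 + d * chi R Z f)).
  by apply: eq_av => Z; apply: perm_big; rewrite perm_catC /= perm_cons perm_catC.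
case: ifP => es; last by rewrite /= -!swap.
apply: (le_trans (IH t)); rewrite -subr_ge0 -avB.
rewrite (@eq_av _ _ _ (fun Z => d * (\prod_(f <- s ++ t) (1 + d * chi R Z f) *
   chr R (val e) Z))); last by move=> Z; rewrite big_cons /chi; ring.
by rewrite avZ mulr_ge0// av_prod_chr_ge0.
Qed.

Lemma av_tuple_prod (T : finType) q (f : T -> R) :
  av (fun es : q.-tuple T => \prod_(e <- es) f e) = av f ^+ q.
Proof.
elim: q => [|q IH]; first by rewrite av_tuple0 big_nil expr0.
rewrite av_tupleS exprS -IH -avZr; apply: eq_av => e.
by rewrite -avZ; apply: eq_av => es; rewrite big_cons.
Qed.

Hypothesis n_pairs : (0 < #|vpair n|)%N.

(** Restoring the repetitions makes the factors independent: for fixed [Z] the average over tuples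
    is a [q]-th power, at most [exp (tau \sum_e chi Z e)]. Then [av_exp_chi] applies with
    [rho = n tau], since [2 #|vpair n| <= n^2]. *)
Lemma av_second_moment q (beta tau : R) : `|beta| < 1 ->
  tau = q%:R * beta ^+ 2 / #|vpair n|%:R -> n%:R * tau <= 8^-1 ->
  av (fun es : q.-tuple (vpair n) => av (fun G =>
    av (fun X => likS beta (undup es) X G) ^+ 2)) <= expR (n%:R * tau / 2).
Proof.
move=> b1 tauE ntau; set d := beta ^+ 2.
have d0 : 0 <= d by exact: sqr_ge0.
have d1 : d < 1 by rewrite /d -real_normK ?num_real// exprn_ilt1.
apply: (@le_trans _ _ (av (fun es : q.-tuple (vpair n) => av (fun Z =>
    \prod_(e <- es) (1 + d * chi R Z e))))).
  apply: le_av => es; rewrite av_likS_avg_sqr ?undup_uniq//.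
  by have := @av_prod_undup d es [::] d0; rewrite !cats0.
rewrite av_exchange.
have N0 : 0 < (#|vpair n|%:R : R) by rewrite ltr0n.
have tau0 : 0 <= tau by rewrite tauE; exact: (divr_ge0 (mulr_ge0 (ler0n _ _) d0) (ltW N0)).
apply: le_trans (@av_exp_chi R n (fun=> tau) (n%:R * tau) _ ntau _); last 2 first.
- by rewrite mulr_ge0 ?ler0n.
- rewrite sumr_const -[tau ^+ 2 *+ _]mulr_natl mulrA (card_vpair R n) exprMn.
  by rewrite ler_wpM2r ?sqr_ge0// lerBlDr lerDl ler0n.
apply: le_av => Z; rewrite av_tuple_prod avD av_cst// avZ.
have av1 : - 1 <= av (chi R Z).
  rewrite -(@av_cst R (vpair n) (-1))//; apply: le_av => e.
  by rewrite lerNl (le_trans (ler_norm _))// normrN norm_chi.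
have pos : 0 <= 1 + d * av (chi R Z) by nra.
have -> : \sum_(e : vpair n) tau * chi R Z e = (d * av (chi R Z)) *+ q.
  by rewrite -mulr_sumr tauE /av -[RHS]mulr_natr /d; field; rewrite gt_eqF.
by rewrite -[_ *+ q]mulr_natl expRM_natl lerXn2r ?nnegrE ?expR_ge0// expR_ge1Dx.
Qed.

(** For fixed queries with likelihood ratio [L], the sum is at most the mean of [max (L, 1)]. AM-GM
    with weight [kappa] bounds [L - 1] by [kappa / 2 + (L - 1)^2 / (2 kappa)], and the mean of the
    square is the second moment minus 1. *)
Lemma transcript_indistinguishable q (beta kappa tau : R)
    (acc : {set vpair n} -> q.-tuple (vpair n) -> bool) :
  (forall (es : q.-tuple (vpair n)) e G, e \notin es -> acc (flip e G) es = acc G es) ->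
  `|beta| < 1 -> 0 < kappa ->
  tau = q%:R * beta ^+ 2 / #|vpair n|%:R -> n%:R * tau <= 8^-1 ->
  av (fun G => lik_avg beta G * av (fun es : q.-tuple (vpair n) => (acc G es)%:R)) +
  av (fun G => av (fun es : q.-tuple (vpair n) => (~~ acc G es)%:R)) <=
  1 + kappa / 2 + (expR (n%:R * tau / 2) - 1) / (2 * kappa).
Proof.
move=> accinv b1 k0 tauE ntau.
pose L (es : q.-tuple (vpair n)) G := av (fun X => likS beta (undup es) X G).
have avL es : av (L es) = 1.
  rewrite /L av_exchange (@eq_av _ _ _ (fun=> 1)) ?av_cst ?card_sets_gt0//.
  by move=> X; rewrite av_likS ?undup_uniq.
have -> : av (fun G => lik_avg beta G * av (fun es : q.-tuple (vpair n) => (acc G es)%:R))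
    = av (fun es => av (fun G => L es G * (acc G es)%:R)).
  rewrite (@eq_av _ _ _ (fun G => av (fun es : q.-tuple (vpair n) =>
     av (fun X => lik beta X G * (acc G es)%:R)))).
    rewrite [LHS]av_exchange; apply: eq_av => es.
    rewrite [LHS]av_exchange [RHS](@eq_av _ _ _ (fun G => av (fun X => likS beta (undup es) X G * (acc G es)%:R))).
      rewrite [RHS]av_exchange; apply: eq_av => X.
      apply: (@av_lik_restrict beta (undup es) X (fun G => (acc G es)%:R)).
        exact: undup_uniq.
      by move=> e G; rewrite mem_undup => /accinv ->.
    by move=> G; rewrite avZr.
  by move=> G; rewrite -avZ; apply: eq_av => es; rewrite avZr.
rewrite [X in _ + X]av_exchange -avD.
have tup0 : (0 < #|{: q.-tuple (vpair n)}|)%N by rewrite card_tuple expn_gt0 n_pairs.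
apply: (@le_trans _ _ (av (fun es => 1 + kappa / 2 +
    (av (fun G => L es G ^+ 2) - 1) / (2 * kappa)))).
  apply: le_av => es; rewrite -avD.
  apply: (@le_trans _ _ (av (fun G => 1 + kappa / 2 +
      (L es G ^+ 2 - 2 * L es G + 1) / (2 * kappa)))).
    apply: le_av => G.
    have sq : L es G ^+ 2 - 2 * L es G + 1 = (L es G - 1) ^+ 2 by ring.
    rewrite sq; set y := L es G.
    have amgm : y - 1 <= kappa / 2 + (y - 1) ^+ 2 / (2 * kappa).
      rewrite -subr_ge0.
      have -> : kappa / 2 + (y - 1) ^+ 2 / (2 * kappa) - (y - 1) =
        (kappa - (y - 1)) ^+ 2 / (2 * kappa) by field; rewrite gt_eqF.
      by rewrite divr_ge0 ?sqr_ge0// mulr_ge0// ltW.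
    have pos : 0 <= (y - 1) ^+ 2 / (2 * kappa).
      by rewrite divr_ge0 ?sqr_ge0// mulr_ge0// ltW.
    by case: (acc G es) => /=; lra.
  rewrite avD av_cst ?card_sets_gt0// avZr avD avB avZ avL av_cst ?card_sets_gt0//.
  by rewrite le_eqVlt; apply/orP; left; apply/eqP; ring.
rewrite avD av_cst// avZr avB av_cst// lerD2l ler_wpM2r//.
  by rewrite invr_ge0 mulr_ge0// ltW.
by rewrite lerB// av_second_moment.
Qed.

End SecondMoment.

(** * Cut sizes of random graphs *)

Section Cuts.
Variables (R : realType) (n : nat).
Implicit Types (X : {set 'I_n}) (G : {set vpair n}) (e : vpair n).
Implicit Types (P : {ffun 'I_n -> bool}).

Lemma crossesE P e (a b : 'I_n) : a != b -> val e = [set a; b]%SET ->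
  crosses P e = (P a != P b).
Proof.
move=> ab eE; rewrite /crosses eE; apply/existsP/idP.
  case=> u /existsP[v /and3P[Pu Pv /eqP E]].
  have ua : u \in [set a; b]%SET by rewrite E !inE eqxx.
  have va : v \in [set a; b]%SET by rewrite E !inE eqxx orbT.
  move: ua va Pu Pv; rewrite !inE.
  by case/orP => /eqP ->; case/orP => /eqP ->;
    case: (P a); case: (P b).
case Pa: (P a); case Pb: (P b) => // _.
  by exists b; apply/existsP; exists a; rewrite Pa Pb finset.setUC eqxx.
by exists a; apply/existsP; exists b; rewrite Pa Pb eqxx.
Qed.

Definition side P : {set 'I_n} := [set u | P u]%SET.

Lemma crosses_chi P e : (crosses P e)%:R = (1 - chi R (side P) e) / 2.
Proof.
have [a [b [ab eE]]] := vpairP e; rewrite (crossesE P ab eE) /chi eE chr_pair//.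
by rewrite /spin !inE; case: (P a); case: (P b) => /=; field.
Qed.

Lemma cutE G P : (cut G P)%:R =
  \sum_(e : vpair n) (1 + spin R G e) / 2 * ((1 - chi R (side P) e) / 2).
Proof.
rewrite /cut -sum1_card natr_sum big_mkcond; apply: eq_bigr => e _.
by rewrite inE -crosses_chi /spin; case: (e \in G); case: (crosses P e) => /=; field.
Qed.

(** Centres the correlation of edges and cut at its planted mean [beta]: when [P] is the planted
    cut, the three sums are mere fluctuations. *)
Lemma cut_moments (beta : R) G P : (cut G P)%:R =
  (#|vpair n|%:R * (1 - beta) - \sum_(e : vpair n) chi R (side P) e +
   \sum_(e : vpair n) spin R G e -
   \sum_(e : vpair n) (spin R G e * chi R (side P) e - beta)) / 4.
Proof.
have NE : (#|vpair n|%:R : R) = \sum_(e : vpair n) 1 by rewrite sumr_const.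
rewrite cutE NE [X in X - _ + _ - _]mulr_suml -!sumrB -big_split -sumrB mulr_suml.
by apply: eq_bigr => e _ /=; field.
Qed.

Definition signed_cut X G : R :=
  \sum_(e : vpair n) ((1 - chi R X e) / 2) * spin R G e.

(** The first term is half the number of separated pairs, that is, the mean over uniform graphs. It
    is at most [n^2 / 8], with equality at bisections. *)
Lemma cut_signed G P : (cut G P)%:R =
  (n%:R ^+ 2 - (\sum_u spin R (side P) u) ^+ 2) / 8 + signed_cut (side P) G / 2.
Proof.
rewrite sum_spin_sqr.
have -> : n%:R ^+ 2 - (n%:R + 2 * \sum_(e : vpair n) chi R (side P) e) =
    2 * \sum_(e : vpair n) (1 - chi R (side P) e).
  rewrite sumrB sumr_const; have := card_vpair R n; lra.
rewrite cutE mulr_sumr /signed_cut !mulr_suml -big_split.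
by apply: eq_bigr => e _ /=; field.
Qed.

(** For a sign [x], [exp (c x) = cosh c (1 + x tanh c)]; the odd parts average out and [cosh_le]
    bounds the rest. *)
Lemma av_exp_lin (I : finType) (c : I -> R) :
  av (fun H : {set I} => expR (\sum_i c i * spin R H i)) <=
  expR (2 * \sum_i c i ^+ 2).
Proof.
pose C i := (expR (c i) + expR (- c i)) / 2.
have C0 i : 0 < C i by rewrite divr_gt0// addr_gt0 ?expR_gt0.
rewrite (@eq_av _ _ _ (fun H : {set I} => (\prod_i C i) *
   (1 * \prod_i (1 + (expR (c i) - expR (- c i)) / 2 / C i * spin R H i)))).
  rewrite avZ (@av_prod1 _ _ (index_enum I) _ (fun=> 1)) ?index_enum_uniq//.
  rewrite av_cst ?card_sets_gt0// mulr1 mulr_sumr expR_sum.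
  by apply: ler_prod => i _; rewrite (ltW (C0 i)) cosh_le.
move=> H; rewrite mul1r -big_split expR_sum; apply: eq_bigr => i _ /=.
have Ci : C i != 0 by rewrite gt_eqF.
rewrite mulrDr mulr1 mulrA mulrCA divff// mulr1 /C /spin.
by case: (i \in H); rewrite ?mulrN1 ?mulr1; field.
Qed.

(** A Chernoff bound for each cut and a union bound over the [2^n <= exp n] cuts; [sgn] selects the
    tail. *)
Lemma signed_cut_tail (T sgn : R) : (0 < n)%N -> 0 <= T -> sgn ^+ 2 = 1 ->
  av (fun G => [exists X, T < sgn * signed_cut X G]%:R) <=
  expR (n%:R - T ^+ 2 / (4 * n%:R ^+ 2)) :> R.
Proof.
move=> n0 T0 s2; have nR : 0 < (n%:R : R) by rewrite ltr0n.
(* The minimizer of the exponent [- lam T + lam^2 n^2]. *)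
pose lam := T / (2 * n%:R ^+ 2).
have lam0 : 0 <= lam by rewrite divr_ge0// mulr_ge0// sqr_ge0.
apply: (@le_trans _ _ (av (fun G => \sum_X
    expR (- (lam * T)) * expR (\sum_(e : vpair n)
      (lam * sgn * ((1 - chi R X e) / 2)) * spin R G e)))).
  apply: le_av => G; case: existsP => [[X TX]|_] /=; last first.
    by apply: sumr_ge0 => X _; rewrite mulr_ge0 ?expR_ge0.
  rewrite (bigD1 X)//= -expRD.
  apply: (@le_trans _ _ (expR 0)); first by rewrite expR0.
  apply: (@le_trans _ _ (expR (- (lam * T) + lam * (sgn * signed_cut X G)))).
    by rewrite ler_expR addrC subr_ge0 ler_wpM2l// ltW.
  have -> : lam * (sgn * signed_cut X G) = \sum_(e : vpair n)
      (lam * sgn * ((1 - chi R X e) / 2)) * spin R G e.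
    by rewrite /signed_cut !mulr_sumr; apply: eq_bigr => e _; ring.
  rewrite lerDl; apply: sumr_ge0 => Y _; rewrite mulr_ge0 ?expR_ge0//.
rewrite av_sum.
apply: (@le_trans _ _ (\sum_(X : {set 'I_n})
    expR (- (lam * T) + lam ^+ 2 * n%:R ^+ 2))).
  apply: ler_sum => X _; rewrite avZ expRD ler_wpM2l ?expR_ge0//.
  apply: (le_trans (av_exp_lin _)); rewrite ler_expR.
  have le1 e : (lam * sgn * ((1 - chi R X e) / 2)) ^+ 2 <= lam ^+ 2.
    have -> : (lam * sgn * ((1 - chi R X e) / 2)) ^+ 2 =
      lam ^+ 2 * (sgn ^+ 2 * ((1 - chi R X e) / 2) ^+ 2) by ring.
    rewrite s2 mul1r ler_piMr ?sqr_ge0//.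
    have := norm_chi R X e; case: (ger0P (chi R X e)) => _ h.
      by rewrite h subrr mul0r expr0n.
    have -> : chi R X e = -1 by rewrite -h opprK.
    by rewrite opprK divff ?pnatr_eq0// expr1n.
  apply: (@le_trans _ _ (2 * \sum_(e : vpair n) lam ^+ 2)).
    by rewrite ler_wpM2l// ler_sum// => e _; exact: le1.
  rewrite sumr_const -[lam ^+ 2 *+ _]mulr_natr mulrCA (card_vpair R n).
  by rewrite ler_wpM2l ?sqr_ge0// lerBlDr lerDl ler0n.
have cards : #|{set 'I_n}| = (2 ^ n)%N.
  by rewrite -finset.cardsT -finset.powersetT card_powerset finset.cardsT card_ord.
rewrite sumr_const cards -[_ *+ (2 ^ n)]mulr_natl natrX.
have e2 : 2 <= expR 1 :> R by have := @expR_ge1Dx R 1; lra.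
have en : 2 ^+ n <= expR n%:R :> R.
  by rewrite -[n%:R]mulr1 expRM_natl lerXn2r// nnegrE ?expR_ge0.
apply: (@le_trans _ _ (expR n%:R * expR (- (lam * T) + lam ^+ 2 * n%:R ^+ 2))).
  by rewrite ler_wpM2r ?expR_ge0.
rewrite -expRD ler_expR le_eqVlt; apply/orP; left; apply/eqP.
by rewrite /lam; field; rewrite gt_eqF.
Qed.

(** Distinct pairs have distinct characters, hence orthogonal ones. *)
Lemma av_chi_sqr (c : vpair n -> R) :
  av (fun X => (\sum_(e : vpair n) c e * chi R X e) ^+ 2) =
  \sum_(e : vpair n) c e ^+ 2.
Proof.
rewrite (@eq_av _ _ _ (fun X => \sum_(e : vpair n) \sum_(f : vpair n)
   (c e * c f) * (chi R X e * chi R X f))); last first.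
  move=> X; rewrite expr2 mulr_suml; apply: eq_bigr => e _.
  by rewrite mulr_sumr; apply: eq_bigr => f _; ring.
rewrite av_sum; apply: eq_bigr => e _; rewrite av_sum (bigD1 e)//= avZ.
rewrite (@eq_av _ _ _ (fun=> 1)) ?av_cst ?card_sets_gt0//; last first.
  by move=> X; rewrite -expr2 sqr_chi.
rewrite mulr1 big1 ?addr0// => f fe; rewrite avZ.
rewrite (@eq_av _ _ _ (chr R (val e :\: val f :|: val f :\: val e)%SET)).
  rewrite av_chr ?mulr0//; apply: contraNneq fe => E; apply/eqP/val_inj/setP => u.
  have : u \notin (val e :\: val f :|: val f :\: val e)%SET by rewrite E inE.
  by rewrite !inE; case: (u \in val e); case: (u \in val f).
by move=> X; rewrite -chrM.
Qed.

(** Multiplies the sign of each pair [e] by [chi X e]. This change of variables turns the graph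
    planted at [X] into one with independent edges of constant bias [beta], of density [lik1]. *)
Definition twist X G : {set vpair n} :=
  symdiff [set e | chi R X e == 1]%SET G.

Lemma spin_twist X G e : spin R (twist X G) e = chi R X e * spin R G e.
Proof.
rewrite spin_symdiff; congr (_ * _); rewrite /spin inE.
case: eqP => [->//|ne]; have /eqP := sqr_chi R X e.
by rewrite sqrf_eq1 => /orP[/eqP //|/eqP ->].
Qed.

Definition lik1 (beta : R) G : R := \prod_(e : vpair n) (1 + beta * spin R G e).

Lemma av_lik_twist beta X (f : {set vpair n} -> R) :
  av (fun G => lik beta X G * f G) = av (fun G => lik1 beta G * f (twist X G)).
Proof.
rewrite -(@av_bij _ _ (twist X)); last exact: inv_bij (symdiffK _).
apply: eq_av => G; congr (_ * _); apply: eq_bigr => e _.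
by rewrite spin_twist mulrA -[beta * _ * _]mulrA -expr2 sqr_chi mulr1.
Qed.

Lemma av_lik1 beta : av (lik1 beta) = 1.
Proof.
have := @av_prod1 R _ (index_enum (vpair n)) (fun=> beta) (fun=> 1)
  (index_enum_uniq _).
rewrite av_cst ?card_sets_gt0// => <-//.
by apply: eq_av => G; rewrite mul1r.
Qed.

Lemma lik1_ge0 beta G : `|beta| <= 1 -> 0 <= lik1 beta G.
Proof.
move=> b1; apply: prodr_ge0 => e _.
have : `|beta * spin R G e| <= 1 by rewrite normrM norm_spin mulr1.
rewrite ler_norml => /andP[]; lra.
Qed.

Lemma av_lik1_sqr beta : `|beta| <= 1 ->
  av (fun G => lik1 beta G * (\sum_(e : vpair n) (spin R G e - beta)) ^+ 2) <=
  4 * #|vpair n|%:R.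
Proof.
move=> b1.
rewrite (@eq_av _ _ _ (fun G => \sum_(e : vpair n) \sum_(f : vpair n)
   lik1 beta G * ((spin R G e - beta) * (spin R G f - beta)))); last first.
  move=> G; rewrite expr2 mulr_suml mulr_sumr; apply: eq_bigr => e _.
  by rewrite !mulr_sumr; apply: eq_bigr => f _; ring.
rewrite av_sum.
have -> : 4 * #|vpair n|%:R = \sum_(e : vpair n) 4 :> R.
  by rewrite sumr_const -[RHS]mulr_natr.
apply: ler_sum => e _; rewrite av_sum (bigD1 e)//=.
rewrite [X in _ + X]big1 ?addr0; last first.
  (* The factor [(1 + beta s)(s - beta)] equals [(1 - beta^2) s] for a sign [s], hence is odd under
     [flip e]. *)
  move=> f fe; apply: (@av_odd _ _ e) => G; rewrite /lik1.
  rewrite (bigD1 e)//= [in RHS](bigD1 e)//= !spin_flip spin_flip_neq//.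
  rewrite (eq_bigr (fun g => 1 + beta * spin R G g)); last first.
    by move=> g ge; rewrite spin_flip_neq.
  have s2 := sqr_spin R G e; set s := spin R G e in s2 *.
  set Pi := \prod_(_ | _) _; set y := spin R G f - beta.
  transitivity (Pi * y * (- s + beta ^+ 2 * s - beta + beta * s ^+ 2)).
    by ring.
  transitivity (- (Pi * y * (s - beta ^+ 2 * s - beta + beta * s ^+ 2))).
    by rewrite s2; ring.
  by ring.
apply: (@le_trans _ _ (av (fun G => lik1 beta G * 4))).
  apply: le_av => G; rewrite ler_wpM2l ?lik1_ge0// -expr2 -real_normK ?num_real//.
  have : `|spin R G e - beta| <= 2.
    by rewrite (le_trans (ler_normB _ _))// norm_spin; lra.
  have := normr_ge0 (spin R G e - beta); nra.
by rewrite avZr av_lik1 mul1r.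
Qed.

(** Chebyshev for the three fluctuations of [cut_moments]. After [twist], the second one is a sum of
    [spin G e * chi X e], handled by averaging over [X]; the last two contribute 1 and 4 to the
    constant 5. *)
Lemma planted_tail (beta u t : R) (bad : {set vpair n} -> bool) :
  `|beta| <= 1 -> 0 < u -> 0 < t ->
  (forall X G, bad G ->
    [\/ u ^+ 2 <= (\sum_(e : vpair n) chi R X e) ^+ 2,
        t ^+ 2 <= (\sum_(e : vpair n) spin R G e) ^+ 2 |
        t ^+ 2 <= (\sum_(e : vpair n) (spin R G e * chi R X e - beta)) ^+ 2]) ->
  av (fun G => lik_avg beta G * (bad G)%:R) <=
  #|vpair n|%:R / u ^+ 2 + 5 * #|vpair n|%:R / t ^+ 2.
Proof.
move=> b1 u0 t0 badP.
have u2 : 0 < u ^+ 2 by rewrite exprn_gt0.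
have t2 : 0 < t ^+ 2 by rewrite exprn_gt0.
pose Q1 X := \sum_(e : vpair n) chi R X e.
pose Q2 G := \sum_(e : vpair n) spin R G e.
pose Q3 X G := \sum_(e : vpair n) (spin R G e * chi R X e - beta).
apply: (@le_trans _ _ (av (fun X => av (fun G => lik beta X G *
    (Q1 X ^+ 2 / u ^+ 2 + Q2 G ^+ 2 / t ^+ 2 + Q3 X G ^+ 2 / t ^+ 2))))).
  rewrite av_exchange; apply: le_av => G; rewrite /lik_avg -avZr.
  apply: le_av => X; rewrite ler_wpM2l ?lik_ge0//.
  have h1 : 0 <= Q1 X ^+ 2 / u ^+ 2 by rewrite divr_ge0 ?sqr_ge0.
  have h2 : 0 <= Q2 G ^+ 2 / t ^+ 2 by rewrite divr_ge0 ?sqr_ge0.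
  have h3 : 0 <= Q3 X G ^+ 2 / t ^+ 2 by rewrite divr_ge0 ?sqr_ge0.
  case E: (bad G) => /=; last by lra.
  case: (badP X G E) => h.
  - have : 1 <= Q1 X ^+ 2 / u ^+ 2 by rewrite ler_pdivlMr// mul1r.
    lra.
  - have : 1 <= Q2 G ^+ 2 / t ^+ 2 by rewrite ler_pdivlMr// mul1r.
    lra.
  - have : 1 <= Q3 X G ^+ 2 / t ^+ 2 by rewrite ler_pdivlMr// mul1r.
    lra.
under eq_av do rewrite av_lik_twist.
have N1 : \sum_(e : vpair n) 1 = #|vpair n|%:R :> R by rewrite sumr_const.
rewrite av_exchange.
apply: (@le_trans _ _ (av (fun G => lik1 beta G * (#|vpair n|%:R / u ^+ 2 +
   #|vpair n|%:R / t ^+ 2 + (\sum_(e : vpair n) (spin R G e - beta)) ^+ 2 / t ^+ 2)))).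
  apply: le_av => G; rewrite avZ ler_wpM2l ?lik1_ge0// !avD !avZr.
  have -> : av (fun X => Q1 X ^+ 2) = #|vpair n|%:R.
    have := av_chi_sqr (fun=> 1); under eq_bigr do rewrite expr1n.
    rewrite N1 => <-; apply: eq_av => X; congr (_ ^+ 2).
    by apply: eq_bigr => e _; rewrite mul1r.
  have -> : av (fun X => Q2 (twist X G) ^+ 2) = #|vpair n|%:R.
    have := av_chi_sqr (fun e => spin R G e).
    under eq_bigr do rewrite sqr_spin; rewrite N1 => <-.
    apply: eq_av => X; congr (_ ^+ 2); apply: eq_bigr => e _.
    by rewrite spin_twist mulrC.
  rewrite lerD2l ler_wpM2r ?invr_ge0 ?(ltW t2)//.
  rewrite (@eq_av _ _ _ (fun=> (\sum_(e : vpair n) (spin R G e - beta)) ^+ 2)).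
    by rewrite av_cst ?card_sets_gt0.
  move=> X; congr (_ ^+ 2); apply: eq_bigr => e _.
  by rewrite spin_twist mulrAC -expr2 sqr_chi mul1r.
rewrite (@eq_av _ _ _ (fun G => lik1 beta G * (#|vpair n|%:R / u ^+ 2 +
   #|vpair n|%:R / t ^+ 2) + lik1 beta G *
   (\sum_(e : vpair n) (spin R G e - beta)) ^+ 2 / t ^+ 2)); last first.
  by move=> G; rewrite mulrDr mulrA.
rewrite avD !avZr av_lik1 mul1r -addrA lerD2l.
have -> : 5 * #|vpair n|%:R / t ^+ 2 =
  #|vpair n|%:R / t ^+ 2 + 4 * #|vpair n|%:R / t ^+ 2 by ring.
by rewrite lerD2l ler_wpM2r ?invr_ge0 ?(ltW t2)// av_lik1_sqr.
Qed.

End Cuts.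

(** * Rebalancing a cut, and optimal cuts *)

Lemma subset_of_card (T : finType) (A : {set T}) (k : nat) : (k <= #|A|)%N ->
  exists B : {set T}, B \subset A /\ #|B| = k.
Proof.
move=> kA; exists [set x in take k (enum A)]%SET; split.
  by apply/fintype.subsetP => x; rewrite inE => /mem_take; rewrite mem_enum.
rewrite cardsE; have /card_uniqP -> : uniq (take k (enum A)).
  by rewrite take_uniq// enum_uniq.
by rewrite size_take -cardE; case: ltngtP kA.
Qed.

Section Bisections.
Variables (R : realType) (n : nat).
Implicit Types (X : {set 'I_n}) (G : {set vpair n}) (e : vpair n).
Implicit Types (P : {ffun 'I_n -> bool}).

Definition indic X : {ffun 'I_n -> bool} := [ffun u => u \in X].

Lemma side_indic X : side (indic X) = X.
Proof. by apply/setP => u; rewrite inE ffunE. Qed.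

Lemma card_pairs_meeting (D : {set 'I_n}) :
  (#|[set e : vpair n | ~~ [disjoint val e & D]]%SET| <= #|D| * n)%N.
Proof.
rewrite -(card_imset _ val_inj) -[X in (_ <= _ * X)%N]card_ord -finset.cardsT -cardsX.
apply: leq_trans (leq_imset_card (fun p : 'I_n * 'I_n => [set p.1; p.2]%SET) _).
apply: subset_leq_card; apply/fintype.subsetP => A /imsetP[e + ->].
rewrite inE -setI_eq0 => /finset.set0Pn[u]; rewrite inE => /andP[ue uD].
have [a [b [ab eE]]] := vpairP e; move: ue; rewrite eE !inE => /orP[] /eqP uE.
  by apply/imsetP; exists (a, b); rewrite ?inE -?uE ?uD.
by apply/imsetP; exists (b, a); rewrite ?inE -?uE ?uD//= finset.setUC.
Qed.

Lemma cut_move G X Y :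
  (cut G (indic Y) <= cut G (indic X) + #|X :\: Y :|: Y :\: X| * n)%N.
Proof.
set D := (_ :|: _)%SET.
apply: leq_trans (leq_add (leqnn _) (card_pairs_meeting D)).
rewrite /cut; apply: leq_trans (leq_card_setU _ _).
apply: subset_leq_card; apply/fintype.subsetP => e; rewrite !inE => /andP[-> cY] /=.
have [a [b [ab eE]]] := vpairP e.
move: cY; rewrite !(crossesE _ ab eE) !ffunE -setI_eq0 eE => cY.
case: eqVneq => //= /eqP aXY; apply/finset.set0Pn.
have [aD|aD] := boolP (a \in D); first by exists a; rewrite finset.in_setI aD !inE eqxx.
exists b; rewrite finset.in_setI.
have -> : b \in [set a; b]%SET by rewrite !inE eqxx orbT.
by move: aD cY aXY; rewrite !inE; case: (a \in X); case: (a \in Y); case: (b \in X); case: (b \in Y).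
Qed.

Lemma sum_spin X : \sum_u spin R X u = 2 * #|X|%:R - n%:R.
Proof.
rewrite -sum1_card natr_sum mulr_sumr [X in X - _]big_mkcond /=.
have -> : n%:R = \sum_(u < n) 1 :> R by rewrite sumr_const card_ord.
rewrite -sumrB; apply: eq_bigr => u _; rewrite /spin.
by case: (u \in X); ring.
Qed.

(** Balancing [X] moves half of [|\sum_u spin X u|] vertices, each of which affects at most [n]
    pairs. *)
Lemma near_bisection G X : ~~ odd n -> exists P, is_bisection P /\
  (cut G P)%:R <= (cut G (indic X))%:R + `|\sum_u spin R X u| / 2 * n%:R.
Proof.
move=> en.
suff [Y [cY cD]] : exists Y : {set 'I_n}, #|Y| = n./2 /\
    #|X :\: Y :|: Y :\: X|%:R = `|\sum_u spin R X u| / 2.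
  exists (indic Y); split; first by rewrite /is_bisection -/(side _) side_indic cY.
  by rewrite -cD -natrM -natrD ler_nat cut_move.
have n2 : n%:R = 2 * (n./2)%:R :> R by rewrite -natrM mul2n even_halfK.
rewrite sum_spin n2.
have [le|lt] := leqP n./2 #|X|.
  have [Y [YX cY]] := subset_of_card le; exists Y; split => //.
  have -> : (Y :\: X = finset.set0)%SET by apply/eqP; rewrite finset.setD_eq0.
  rewrite finset.setU0 cardsD (finset.setIidPr YX) cY natrB//.
  have : ((n./2)%:R : R) <= #|X|%:R by rewrite ler_nat.
  move=> h; rewrite ger0_norm; first by field.
  by rewrite subr_ge0 ler_wpM2l.
have le : (n./2 <= #|~: X|)%N.
  have := cardsC X; rewrite card_ord; have := even_halfK en; rewrite -mul2n; lia.
have [B [BX cB]] := subset_of_card le; exists (~: B)%SET.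
have cnB : #|(~: B)%SET| = n./2.
  by have := cardsC B; rewrite card_ord cB; have := even_halfK en; rewrite -mul2n; lia.
split => //.
have XB : X \subset (~: B)%SET by rewrite -finset.setCS finset.setCK.
have -> : (X :\: ~: B = finset.set0)%SET by apply/eqP; rewrite finset.setD_eq0.
rewrite finset.set0U cardsD (finset.setIidPr XB) cnB natrB ?(ltnW lt)//.
have : (#|X|%:R : R) <= (n./2)%:R by rewrite ler_nat ltnW.
move=> h; rewrite ler0_norm; first by field.
by rewrite subr_le0 ler_wpM2l.
Qed.

Lemma sum_spin_bisection P : ~~ odd n -> is_bisection P ->
  \sum_u spin R (side P) u = 0.
Proof.
move=> en /eqP cP; rewrite sum_spin cP.
have n2 : n%:R = 2 * (n./2)%:R :> R by rewrite -natrM mul2n even_halfK.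
by rewrite n2 subrr.
Qed.

Lemma minbisection_le G P : is_bisection P -> (minbisection G <= cut G P)%N.
Proof.
move=> bP; rewrite /minbisection; have := mem_index_enum P.
elim: (index_enum _) => // Q r IH; rewrite inE big_cons => /orP[/eqP <-|/IH h].
  by rewrite bP geq_minl.
by case: ifP => // _; rewrite geq_min h orbT.
Qed.

Lemma minbisection_attained G : ~~ odd n ->
  exists2 P, is_bisection P & minbisection G = cut G P.
Proof.
(* Some bisection is needed to dominate the initial value [#|G|] of the minimum. *)
move=> en; have [P0 [bP0 _]] := near_bisection G finset.set0 en.
suff [P bP h] : exists2 P, is_bisection P & (cut G P <= minbisection G)%N.
  by exists P => //; apply/eqP; rewrite eqn_leq h minbisection_le.
rewrite /minbisection.
elim/big_ind: _ => [|x y [P bP hP] [Q bQ hQ]|P bP].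
- exists P0 => //; rewrite /cut subset_leq_card//.
  by apply/fintype.subsetP => e; rewrite inE => /andP[].
- by case: (leqP x y) => h; [exists P | exists Q].
- by exists P.
Qed.

Lemma maxcut_attained G : exists P, maxcut G = cut G P.
Proof.
have c0 : (0 < #|{ffun 'I_n -> bool}|)%N.
  by apply/card_gt0P; exists (indic finset.set0).
by have [P h] := bigop.eq_bigmax (fun P : {ffun 'I_n -> bool} => cut G P) c0; exists P.
Qed.

Lemma maxcut_ge G P : (cut G P <= maxcut G)%N.
Proof. exact: (bigop.leq_bigmax (F := fun P => cut G P) P). Qed.

End Bisections.

(** * The hard instance *)

Section HardInstance.
Variables (R : realType) (n : nat) (eps : R).
Implicit Types (X : {set 'I_n}) (G : {set vpair n}).
Hypothesis eps0 : 0 < eps.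
Hypothesis eps_small : eps < 5 / 100.
Hypothesis eps_large : 100 ^+ 2 <= eps ^+ 2 * n%:R.

Section Scales.
(** [E] is the tolerated error, [t] the deviation allowed to the sums involving edge signs, and [u]
    the one allowed to [\sum_e chi X e], whose standard deviation is of order [n]. *)
Variables m E t u : R.
Hypothesis mE : m = n%:R.
Hypothesis EE : E = eps * m ^+ 2.
Hypothesis tE : t = E / 10.
Hypothesis uE : u = 10 * m.

Let m1 : 1 <= m.
Proof.
rewrite mE ler1n lt0n; apply: contraTneq eps_large => ->.
by rewrite mulr0 -ltNge; lra.
Qed.

Let m0 : 0 < m. Proof. by have := m1; lra. Qed.

Let em : 100 <= eps * m.
Proof.
have : 100 * 100 <= eps * (eps * m) by have := eps_large; rewrite -mE; lra.
by have := eps0; have := eps_small; nra.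
Qed.

Let E_large : 100 * m <= E.
Proof. by rewrite EE expr2 mulrA ler_wpM2r// ltW. Qed.

Let t0 : 0 < t. Proof. by rewrite tE; have := E_large; have := m0; lra. Qed.

Let u0 : 0 < u. Proof. by rewrite uE; have := m0; lra. Qed.

Let pairsE : #|vpair n|%:R = (m ^+ 2 - m) / 2 :> R.
Proof. by have := card_vpair R n; rewrite -mE; lra. Qed.

Lemma sqr_lt_bound (x y : R) : 0 < y -> x ^+ 2 < y ^+ 2 -> - y < x < y.
Proof. by move=> y0 h; apply/andP; split; nra. Qed.

Lemma null_bound (sgn : R) (bad : {set vpair n} -> bool) : sgn ^+ 2 = 1 ->
  (forall G, bad G -> [exists X, t < sgn * signed_cut R X G]) ->
  av (fun G => (bad G)%:R) <= 10^-1 :> R.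
Proof.
move=> s2 badP; apply: (@le_trans _ _ (expR (m - t ^+ 2 / (4 * m ^+ 2)))).
  have n0 : (0 < n)%N by rewrite -(ltr0n R) -mE; exact: m0.
  have := signed_cut_tail n0 (ltW t0) s2; rewrite -mE; apply: le_trans.
  apply: le_av => G; rewrite ler_nat; case Gb: (bad G) => //.
  by rewrite badP.
have ttE : t ^+ 2 / (4 * m ^+ 2) = (eps ^+ 2 * m) * m / 400.
  by rewrite tE EE; field; rewrite gt_eqF.
(* Here [eps^2 n >= 100^2] makes the Chernoff gain beat the term [m] of the union bound. *)
have h : 25 * m <= t ^+ 2 / (4 * m ^+ 2).
  by rewrite ttE; have := eps_large; rewrite -mE; have := m0; nra.
apply: (@le_trans _ _ (expR (- 24))).
  by rewrite ler_expR; have := m1; lra.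
rewrite expRN lef_pV2 ?posrE ?expR_gt0//.
by have := @expR_ge1Dx R 24; lra.
Qed.

Lemma planted_bound (beta : R) (bad : {set vpair n} -> bool) : `|beta| <= 1 ->
  (forall X G, bad G -> ~ [/\
    - u < \sum_(e : vpair n) chi R X e < u,
    - t < \sum_(e : vpair n) spin R G e < t &
    - t < \sum_(e : vpair n) (spin R G e * chi R X e - beta) < t]) ->
  av (fun G => lik_avg beta G * (bad G)%:R) <= 10^-1.
Proof.
move=> b1 badP.
have badP' X G : bad G ->
    [\/ u ^+ 2 <= (\sum_(e : vpair n) chi R X e) ^+ 2,
        t ^+ 2 <= (\sum_(e : vpair n) spin R G e) ^+ 2 |
        t ^+ 2 <= (\sum_(e : vpair n) (spin R G e * chi R X e - beta)) ^+ 2].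
  move=> /badP => /(_ X) h.
  have [h1|h1] := leP (u ^+ 2) ((\sum_(e : vpair n) chi R X e) ^+ 2).
    by constructor 1.
  have [h2|h2] := leP (t ^+ 2) ((\sum_(e : vpair n) spin R G e) ^+ 2).
    by constructor 2.
  have [h3|h3] := leP (t ^+ 2)
    ((\sum_(e : vpair n) (spin R G e * chi R X e - beta)) ^+ 2).
    by constructor 3.
  by exfalso; apply: h; split; apply: sqr_lt_bound.
apply: (le_trans (planted_tail b1 u0 t0 badP')); rewrite pairsE.
have N2 : (m ^+ 2 - m) / 2 <= m ^+ 2 / 2 by have := m0; lra.
have h1 : (m ^+ 2 - m) / 2 / u ^+ 2 <= 200^-1.
  have u2 : u ^+ 2 = 100 * m ^+ 2 by rewrite uE; ring.
  have p2 : 0 < 100 * m ^+ 2 by rewrite mulr_gt0// exprn_gt0// m0.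
  by rewrite u2 (ler_pdivrMr _ _ p2); lra.
have h2 : 5 * ((m ^+ 2 - m) / 2) / t ^+ 2 <= 20^-1.
  rewrite ler_pdivrMr ?exprn_gt0//.
  have -> : t ^+ 2 = (eps ^+ 2 * m) * m ^+ 3 / 100 by rewrite tE EE; field.
  have : 100 * 100 * m ^+ 3 <= (eps ^+ 2 * m) * m ^+ 3.
    rewrite ler_wpM2r ?exprn_ge0 ?(ltW m0)//.
    by have := eps_large; rewrite -mE; lra.
  have : m ^+ 2 <= m ^+ 3 by rewrite [leRHS]exprS ler_peMl ?sqr_ge0 ?m1.
  have := sqr_ge0 m; lra.
lra.
Qed.

Lemma hard_maxcut : exists (hi : R -> bool) (bad1 bad0 : {set vpair n} -> bool),
  [/\ forall G v, ~~ bad1 G -> `|v - (maxcut G)%:R| <= eps * n%:R ^+ 2 -> hi v,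
      forall G v, ~~ bad0 G -> `|v - (maxcut G)%:R| <= eps * n%:R ^+ 2 -> ~~ hi v,
      av (fun G => lik_avg (- (18 * eps)) G * (bad1 G)%:R) <= 10^-1 &
      av (fun G => (bad0 G)%:R) <= 10^-1 :> R].
Proof.
(* Planted values are at least [m^2/8 + 2.1 E] and null values at most [m^2/8 + 0.05 E]. An error of
   [E] leaves [1.1 E] and [1.05 E], on either side of the threshold [1.08 E]. *)
exists (fun v => m ^+ 2 / 8 + 108 / 100 * E <= v).
exists (fun G => ~~ (m ^+ 2 / 8 + 21 / 10 * E <= (maxcut G)%:R)).
exists (fun G => ~~ ((maxcut G)%:R <= m ^+ 2 / 8 + E / 20)).
have b1 : `|- (18 * eps)| <= 1.
  by rewrite normrN ger0_norm; have := eps0; have := eps_small; lra.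
have E0 : 0 < E by have := E_large; have := m0; lra.
split.
- move=> G v; rewrite negbK ler_norml -mE -EE => h /andP[h1 h2]; lra.
- move=> G v; rewrite negbK ler_norml -mE -EE -ltNge => h /andP[h1 h2]; lra.
- apply: planted_bound => // X G; rewrite -ltNge => h [/andP[_ a] /andP[b _] /andP[_ c]].
  have : (cut G (indic X))%:R <= (maxcut G)%:R :> R by rewrite ler_nat maxcut_ge.
  rewrite (cut_moments (- (18 * eps))) side_indic pairsE.
  move: h a b c; rewrite uE tE.
  set q1 := \sum_(_ : vpair n) _; set q2 := \sum_(_ : vpair n) _.
  set q3 := \sum_(_ : vpair n) _; move: (q1) (q2) (q3) ((maxcut G)%:R) => {q1 q2 q3}.
  move=> q1 q2 q3 M h a b c.
  have -> : ((m ^+ 2 - m) / 2 * (1 - - (18 * eps)) - q1 + q2 - q3) / 4 =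
    m ^+ 2 / 8 + 9 / 4 * E - m / 8 - 9 / 4 * (eps * m) - q1 / 4 + q2 / 4 - q3 / 4.
    by rewrite EE; field.
  have : eps * m <= m by rewrite ler_piMl// ?(ltW m0)//; have := eps_small; lra.
  have := E_large; have := m0; lra.
- apply: (@null_bound 1); first by rewrite expr1n.
  move=> G; rewrite -ltNge; have [P ->] := maxcut_attained G.
  rewrite (cut_signed R) -mE => h; apply/existsP; exists (side P); rewrite mul1r.
  have := sqr_ge0 (\sum_u spin R (side P) u); rewrite tE; lra.
Qed.

Lemma hard_minbisection : ~~ odd n ->
  exists (hi : R -> bool) (bad1 bad0 : {set vpair n} -> bool),
  [/\ forall G v, ~~ bad1 G -> `|v - (minbisection G)%:R| <= eps * n%:R ^+ 2 -> hi v,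
      forall G v, ~~ bad0 G -> `|v - (minbisection G)%:R| <= eps * n%:R ^+ 2 -> ~~ hi v,
      av (fun G => lik_avg (18 * eps) G * (bad1 G)%:R) <= 10^-1 &
      av (fun G => (bad0 G)%:R) <= 10^-1 :> R].
Proof.
move=> en.
exists (fun v => v <= m ^+ 2 / 8 - 108 / 100 * E).
exists (fun G => ~~ ((minbisection G)%:R <= m ^+ 2 / 8 - 21 / 10 * E)).
exists (fun G => ~~ (m ^+ 2 / 8 - E / 20 <= (minbisection G)%:R)).
have b1 : `|18 * eps| <= 1.
  by rewrite ger0_norm; have := eps0; have := eps_small; lra.
have E0 : 0 < E by have := E_large; have := m0; lra.
split.
- move=> G v; rewrite negbK ler_norml -mE -EE => h /andP[h1 h2]; lra.
- move=> G v; rewrite negbK ler_norml -mE -EE -ltNge => h /andP[h1 h2]; lra.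
- apply: planted_bound => // X G; rewrite -ltNge => h [/andP[a1 a] /andP[_ b] /andP[c _]].
  have [P [bP cP]] := near_bisection R G X en.
  have : (minbisection G)%:R <= (cut G P)%:R :> R by rewrite ler_nat minbisection_le.
  move=> /le_trans /(_ cP).
  have ss := sum_spin_sqr R X; rewrite -mE in ss *.
  rewrite (cut_moments (18 * eps)) side_indic pairsE.
  (* The planted cut need not be a bisection. By [sum_spin_sqr] its squared imbalance is at most
     [m + 2 u = 21 m], so rebalancing costs order [m sqrt m], small against [E] because
     [eps sqrt m >= 100]. *)
  have move_le : `|\sum_u spin R X u| / 2 * m <= E / 20.
    set y := `|_|.
    have y2 : y ^+ 2 <= 21 * m.
      by rewrite /y real_normK ?num_real// ss; move: a; rewrite uE; lra.
    have yy0 : 0 <= y / 2 * m by rewrite mulr_ge0 ?divr_ge0 ?normr_ge0// ltW.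
    have EE0 : 0 <= E / 20 by lra.
    rewrite -ler_sqr ?nnegrE//.
    have -> : (y / 2 * m) ^+ 2 = y ^+ 2 * m ^+ 2 / 4 by field.
    have -> : (E / 20) ^+ 2 = (eps ^+ 2 * m) * (m * m ^+ 2) / 400 by rewrite EE; field.
    have h1 : y ^+ 2 * m ^+ 2 <= 21 * m * m ^+ 2 by rewrite ler_wpM2r ?sqr_ge0.
    have m3 : 0 <= m * m ^+ 2 by rewrite mulr_ge0 ?sqr_ge0 ?ltW.
    have h2 : 100 * 100 * (m * m ^+ 2) <= (eps ^+ 2 * m) * (m * m ^+ 2).
      by rewrite ler_wpM2r//; have := eps_large; rewrite -mE; lra.
    lra.
  move: h a1 b c; rewrite uE tE; move: move_le.
  set y := `|_| / 2 * m.
  set q1 := \sum_(_ : vpair n) _; set q2 := \sum_(_ : vpair n) _.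
  set q3 := \sum_(_ : vpair n) _.
  move: (y) (q1) (q2) (q3) ((minbisection G)%:R) => {q1 q2 q3}.
  move=> y' q1 q2 q3 M yE h a' b c.
  have -> : ((m ^+ 2 - m) / 2 * (1 - 18 * eps) - q1 + q2 - q3) / 4 =
    m ^+ 2 / 8 - 9 / 4 * E - m / 8 + 9 / 4 * (eps * m) - q1 / 4 + q2 / 4 - q3 / 4.
    by rewrite EE; field.
  have : eps * m <= m by rewrite ler_piMl// ?(ltW m0)//; have := eps_small; lra.
  have := E_large; have := m0; lra.
- apply: (@null_bound (-1)); first by rewrite sqrrN expr1n.
  move=> G; rewrite -ltNge; have [P bP ->] := minbisection_attained R G en.
  rewrite (cut_signed R) (sum_spin_bisection R en bP) expr0n /= subr0 -mE => h.
  apply/existsP; exists (side P); rewrite mulN1r tE; lra.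
Qed.

End Scales.

(** The bias is negative for maximum cut, to raise the planted cut, and positive for minimum
    bisection, to lower it. *)
Lemma hard_instance p : admissible p n -> exists beta : R,
  `|beta| = 18 * eps /\
  exists (hi : R -> bool) (bad1 bad0 : {set vpair n} -> bool),
  [/\ forall G v, ~~ bad1 G -> `|v - (value p G)%:R| <= eps * n%:R ^+ 2 -> hi v,
      forall G v, ~~ bad0 G -> `|v - (value p G)%:R| <= eps * n%:R ^+ 2 -> ~~ hi v,
      av (fun G => lik_avg beta G * (bad1 G)%:R) <= 10^-1 &
      av (fun G => (bad0 G)%:R) <= 10^-1 :> R].
Proof.
have e18 : 0 <= 18 * eps by rewrite mulr_ge0// ltW.
case: p => /= h.
  exists (- (18 * eps)); rewrite normrN ger0_norm//; split=> //.
  exact: (hard_maxcut erefl erefl erefl erefl).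
exists (18 * eps); rewrite ger0_norm//; split=> //.
exact: (hard_minbisection erefl erefl erefl erefl).
Qed.

End HardInstance.

(** * Derandomization *)

Local Open Scope classical_set_scope.

Section Derandomization.
Variable R : realType.

(** The weighted sum of probabilities is the integral of a function bounded by [B] at every tape, so
    that a bound for each fixed tape suffices. *)
Lemma sum_prob_le (d : measure_display) (T : measurableType d)
    (P : probability T R) (J : finType) (c : J -> R) (A : J -> set T) (B : R) :
  (forall j, 0 <= c j) -> (forall j, measurable (A j)) ->
  (forall w, \sum_j c j * \1_(A j) w <= B) ->
  \sum_j c j * fine (P (A j)) <= B.
Proof.
move=> c0 mA hB; rewrite -lee_fin.
have mf j : measurable_fun [set: T] (fun w => ((c j)%:E * (\1_(A j) w)%:E)%E).
  apply: measurable_funeM; apply/measurable_EFinP; exact: measurable_indic.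
have -> : (\sum_j c j * fine (P (A j)))%:E =
    (\int[P]_w (\sum_j (c j)%:E * (\1_(A j) w)%:E))%E.
  rewrite ge0_integral_sum//; last first.
    by move=> j w _; rewrite -EFinM lee_fin mulr_ge0.
  rewrite -sumEFin; apply: eq_bigr => j _.
  rewrite ge0_integralZl_EFin//; last first.
    by apply/measurable_EFinP; exact: measurable_indic.
  rewrite integral_indic// setIT EFinM fineK//.
  exact: fin_num_measure.
apply: (@le_trans _ _ (\int[P]_w (cst B%:E w))%E).
  apply: ge0_le_integral => //.
  - by move=> w _; apply: sume_ge0 => j _; rewrite -EFinM lee_fin mulr_ge0.
  - exact: emeasurable_sum.
  - by move=> w _ /=; under eq_bigr do rewrite -EFinM; rewrite sumEFin lee_fin.
rewrite integral_cst// [X in (_ * X)%E](_ : _ = 1%E) ?mule1//.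
exact: probability_setT.
Qed.

Variables (n s : nat) (A : algorithm R n s).

(** Splitting over the finitely many next memory states writes the event as a finite union. *)
Lemma measurable_run_from (good : set R) t m (xs : seq (vpair n * bool)) :
  measurable good ->
  measurable [set w : alg_tape A |
    exists2 v, run_from w t m xs = Some v & good v].
Proof.
move=> mgood.
have mout t' m' : measurable [set w : alg_tape A | good (alg_output w t' m')].
  by rewrite -[X in measurable X]setTI; exact: alg_output_measurable.
elim: xs t m => [|x xs IH] t m.
  rewrite (_ : [set w | _] = [set w : alg_tape A | alg_halt w t m] `&`
      [set w : alg_tape A | good (alg_output w t m)]).
    by apply: measurableI => //; exact: alg_halt_measurable.
  apply/seteqP; split => w /=; case: ifP => // h.
  - by case=> v [<-].
  - by case.
  - by case=> _ g; exists (alg_output w t m).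
  - by case.
rewrite (_ : [set w | _] = ([set w : alg_tape A | alg_halt w t m] `&`
      [set w : alg_tape A | good (alg_output w t m)]) `|`
    (~` [set w : alg_tape A | alg_halt w t m] `&`
     \bigcup_(m' in [set: s.-tuple bool]) ([set w : alg_tape A | alg_step w t m x = m'] `&`
       [set w : alg_tape A | exists2 v, run_from w t.+1 m' xs = Some v & good v]))).
  apply: measurableU.
    by apply: measurableI => //; exact: alg_halt_measurable.
  apply: measurableI; first by apply: measurableC; exact: alg_halt_measurable.
  apply: fin_bigcup_measurable; first exact: finite_finset.
  by move=> m' _; apply: measurableI => //; exact: alg_step_measurable.
apply/seteqP; split => w /=; case: ifP => h.
- by case=> v [<-] g; left.
- move=> h2; right; split => //.
  by exists (alg_step w t m x).
- case=> [[_ g]|[]//]; by exists (alg_output w t m).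
- by case=> [[]//|[_ [m' _ [/= <- //]]]].
Qed.

Lemma measurable_run (good : set R) (G : graph n) (es : seq (vpair n)) :
  measurable good ->
  measurable [set w : alg_tape A | exists2 v, run w G es = Some v & good v].
Proof.
move=> mgood; rewrite /run.
rewrite (_ : [set w | _] = \bigcup_(m in [set: s.-tuple bool])
   ([set w : alg_tape A | alg_init w = m] `&` [set w : alg_tape A |
     exists2 v, run_from w 0 m [seq (e, e \in G) | e <- es] = Some v & good v])).
  apply: fin_bigcup_measurable; first exact: finite_finset.
  move=> m _; apply: measurableI; first exact: alg_init_measurable.
  exact: measurable_run_from.
apply/seteqP; split => w /=.
  by move=> h; exists (alg_init w).
by case=> m _ [/= <- //].
Qed.

Lemma measurable_dist_le (c r : R) : measurable [set v : R | `|v - c| <= r].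
Proof.
rewrite (_ : [set v | _] = `[c - r, c + r]); first exact: measurable_itv.
by apply/seteqP; split => v /=; rewrite in_itv /= ler_distl.
Qed.

End Derandomization.

(** * An algorithm with a fixed tape as a program *)

Section Programs.
Variables (R : realType) (n s : nat) (A : algorithm R n s) (w : alg_tape A).
Variable hi : R -> bool.

(** An unfinished run counts as rejecting; success concerns only runs that produce an output. *)
Definition accepts (o : option R) : bool := if o is Some v then hi v else false.

(** Two extra states let every run read exactly [q] responses, even after the algorithm has
    stopped. *)
Definition mem_state : finType := (s.-tuple bool + bool)%type.

(* [inr b] remembers the verdict [b] of a run that has already stopped. *)
Definition mem_step (t : nat) (m : mem_state) (x : vpair n * bool) : mem_state :=
  match m with
  | inl m => if alg_halt w t m then inr (hi (alg_output w t m))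
             else inl (alg_step w t m x)
  | inr b => inr b
  end.

Definition mem_accepts (t : nat) (m : mem_state) : bool :=
  match m with
  | inl m => alg_halt w t m && hi (alg_output w t m)
  | inr b => b
  end.

Lemma prog_stopped t b xs : prog mem_step t (inr b) xs = inr b.
Proof. by elim: xs t => //= x xs IH t. Qed.

Lemma accepts_prog t m xs : accepts (run_from w t m xs) =
  mem_accepts (t + size xs) (prog mem_step t (inl m) xs).
Proof.
elim: xs t m => [|x xs IH] t m /=.
  by rewrite addn0; case: ifP.
case: ifP => h /=; first by rewrite prog_stopped.
by rewrite IH addSnnS.
Qed.

Lemma card_mem_state : #|mem_state| = (2 ^ s + 2)%N.
Proof. by rewrite card_sum card_tuple card_bool. Qed.

Lemma accepts_flip (G : {set vpair n}) (es : seq (vpair n)) (e : vpair n) : e \notin es ->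
  accepts (run w (flip e G : graph n) es) = accepts (run w (G : graph n) es).
Proof.
move=> ees; rewrite /run; congr (accepts (run_from _ _ _ _)).
apply/eq_in_map => f fes; rewrite inE.
have -> : (f == e) = false by apply: contraNF ees => /eqP <-.
by case: (f \in G).
Qed.

End Programs.

(** * From approximation to distinguishing *)

Section SuccessGap.
Variables (R : realType) (n s : nat) (A : algorithm R n s) (q : nat).

(** Without the bad graphs, the two distributions keep total mass at least [18/10], and a share of
    [99/100] yields the right verdict: [1.782] in all. The bound [B] for each tape passes to the
    average. *)
Lemma success_gap (p : problem) (eps beta B : R) (hi : R -> bool)
    (bad1 bad0 : {set vpair n} -> bool) :
  (0 < #|vpair n|)%N -> `|beta| <= 1 -> approximates p A q eps ->
  [/\ forall G v, ~~ bad1 G -> `|v - (value p (G : graph n))%:R| <= eps * n%:R ^+ 2 -> hi v,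
      forall G v, ~~ bad0 G -> `|v - (value p (G : graph n))%:R| <= eps * n%:R ^+ 2 -> ~~ hi v,
      av (fun G => lik_avg beta G * (bad1 G)%:R) <= 10^-1 &
      av (fun G => (bad0 G)%:R) <= 10^-1 :> R] ->
  (forall w : alg_tape A,
    av (fun G => lik_avg beta G * av (fun es : q.-tuple (vpair n) =>
      (accepts hi (run w (G : graph n) es))%:R)) +
    av (fun G : {set vpair n} => av (fun es : q.-tuple (vpair n) =>
      (~~ accepts hi (run w (G : graph n) es))%:R)) <= B) ->
  178 / 100 <= B.
Proof.
move=> N0 b1 app [hi1 hi0 pb1 pb0] hB.
pose S (G : {set vpair n}) (es : q.-tuple (vpair n)) : set (alg_tape A) :=
  [set w | exists2 v, run w (G : graph n) es = Some v &
     `|v - (value p (G : graph n))%:R| <= eps * n%:R ^+ 2].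
have mS G es : measurable (S G es).
  exact: (@measurable_run _ _ _ _ _ _ _ (measurable_dist_le _ _)).
pose c (G : {set vpair n}) : R := lik_avg beta G * (~~ bad1 G)%:R + (~~ bad0 G)%:R.
have c0 G : 0 <= c G by rewrite addr_ge0// mulr_ge0// lik_avg_ge0.
have avc : 18 / 10 <= av c.
  rewrite /c avD.
  have bE (b : bool) : (~~ b)%:R = 1 - b%:R :> R by case: b; rewrite ?subrr ?subr0.
  rewrite (@eq_av _ _ _ (fun G => lik_avg beta G - lik_avg beta G * (bad1 G)%:R)); last first.
    by move=> G; rewrite bE; ring.
  rewrite avB av_lik_avg; under [X in _ + X]eq_av do rewrite bE.
  rewrite avB av_cst ?card_sets_gt0//; lra.
apply: (@le_trans _ _ (av (fun G => c G * av (fun es => fine (alg_prob A (S G es)))))).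
  apply: (@le_trans _ _ (av (fun G => c G * (99 / 100)))).
    by rewrite avZr; lra.
  by apply: le_av => G; rewrite ler_wpM2l//; exact: (app G).
pose K : R := (#|{set vpair n}|%:R * #|{: q.-tuple (vpair n)}|%:R)^-1.
have K0 : 0 <= K by rewrite invr_ge0 mulr_ge0.
have avE (f : {set vpair n} -> q.-tuple (vpair n) -> R) :
    av (fun G => c G * av (f G)) = \sum_(j : {set vpair n} * q.-tuple (vpair n))
      (c j.1 * K) * f j.1 j.2.
  rewrite /av mulr_suml -(pair_bigA _ (fun G es => (c G * K) * f G es)) /=.
  apply: eq_bigr => G _; rewrite -mulr_sumr /K invfM; ring.
rewrite avE.
apply: (@sum_prob_le R _ _ (alg_prob A) _ (fun j => c j.1 * K) (fun j => S j.1 j.2)).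
- by move=> j; rewrite mulr_ge0.
- by move=> j; exact: mS.
move=> w; rewrite -(avE (fun G es => \1_(S G es) w)).
apply: le_trans (hB w); rewrite -avD; apply: le_av => G.
rewrite /c mulrDl -!avZ -avD -avD; apply: le_av => es.
rewrite indicE; case: (boolP (w \in S G es)) => [|_]; last first.
  by rewrite !mulr0 addr0 addr_ge0// mulr_ge0// lik_avg_ge0.
rewrite inE => -[v rv hv]; rewrite rv /= !mulr1.
have l0 := lik_avg_ge0 G b1.
have [h1|h1] := boolP (bad1 G); have [h0|h0] := boolP (bad0 G).
- by rewrite /= mulr0 add0r addr_ge0// mulr_ge0.
- by rewrite (hi0 _ _ h0 hv) /= mulr0 add0r lerDr mulr_ge0.
- by rewrite (hi1 _ _ h1 hv).
- by have := hi0 _ _ h0 hv; rewrite (hi1 _ _ h1 hv).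
Qed.

Lemma memory_gap (p : problem) (eps beta lam : R) (hi : R -> bool)
    (bad1 bad0 : {set vpair n} -> bool) :
  (0 < #|vpair n|)%N -> `|beta| <= 1 -> 0 < lam -> lam <= 1 ->
  approximates p A q eps ->
  [/\ forall G v, ~~ bad1 G -> `|v - (value p (G : graph n))%:R| <= eps * n%:R ^+ 2 -> hi v,
      forall G v, ~~ bad0 G -> `|v - (value p (G : graph n))%:R| <= eps * n%:R ^+ 2 -> ~~ hi v,
      av (fun G => lik_avg beta G * (bad1 G)%:R) <= 10^-1 &
      av (fun G => (bad0 G)%:R) <= 10^-1 :> R] ->
  178 / 100 <= 1 + 2 * lam + q%:R * ((level_bound beta (2 ^ s + 2)%:R +
    level_bound 0 (2 ^ s + 2)%:R) / (4 * lam * #|vpair n|%:R)).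
Proof.
move=> N0 b1 l0 l1 app hard; apply: (success_gap N0 b1 app hard) => w.
have := memory_indistinguishable (@mem_step R n s A w hi) (inl (alg_init w))
  N0 q (@mem_accepts R n s A w hi q) b1 l0 l1.
have accE (G : {set vpair n}) (es : q.-tuple (vpair n)) :
   @mem_accepts R n s A w hi q (prog (@mem_step R n s A w hi) 0 (inl (alg_init w))
     [seq (e, e \in G) | e <- es]) = accepts hi (run w (G : graph n) es).
  by rewrite accepts_prog size_map size_tuple add0n.
rewrite card_mem_state; apply: le_trans; rewrite le_eqVlt; apply/orP; left; apply/eqP.
by congr (_ + _); apply: eq_av => G; [congr (_ * _)|]; apply: eq_av => es; rewrite accE.
Qed.

Lemma transcript_gap (p : problem) (eps beta kappa tau : R) (hi : R -> bool)
    (bad1 bad0 : {set vpair n} -> bool) :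
  (0 < #|vpair n|)%N -> `|beta| < 1 -> 0 < kappa ->
  tau = q%:R * beta ^+ 2 / #|vpair n|%:R -> n%:R * tau <= 8^-1 ->
  approximates p A q eps ->
  [/\ forall G v, ~~ bad1 G -> `|v - (value p (G : graph n))%:R| <= eps * n%:R ^+ 2 -> hi v,
      forall G v, ~~ bad0 G -> `|v - (value p (G : graph n))%:R| <= eps * n%:R ^+ 2 -> ~~ hi v,
      av (fun G => lik_avg beta G * (bad1 G)%:R) <= 10^-1 &
      av (fun G => (bad0 G)%:R) <= 10^-1 :> R] ->
  178 / 100 <= 1 + kappa / 2 + (expR (n%:R * tau / 2) - 1) / (2 * kappa).
Proof.
move=> N0 b1 k0 tauE ntau app hard.
apply: (success_gap N0 (ltW b1) app hard) => w.
apply: (@transcript_indistinguishable _ _ N0 _ _ _ _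
  (fun G es => accepts hi (run w (G : graph n) es))) => // es e G ees.
exact: accepts_flip.
Qed.

End SuccessGap.

(** * Lower bound *)

Section Assembly.
Variable R : realType.

Lemma ln_card_le (s : nat) : 0 <= ln ((2 ^ s + 2)%:R : R) <= s%:R + 2.
Proof.
have K0 : 0 < ((2 ^ s + 2)%:R : R) by rewrite ltr0n addn_gt0 orbT.
apply/andP; split; first by rewrite ln_ge0// ler1n addn_gt0 orbT.
rewrite -[leRHS]expRK ler_ln ?posrE ?expR_gt0//.
have e2 : 2 <= expR 1 :> R by have := @expR_ge1Dx R 1; lra.
have -> : s%:R + 2 = (s + 2)%:R :> R by rewrite natrD.
rewrite -[(s + 2)%:R]mulr1 expRM_natl.
apply: (@le_trans _ _ ((2 ^ (s + 2))%:R)).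
  rewrite ler_nat expnD; have := expn_gt0 2 s; rewrite /= => h; lia.
by rewrite natrX lerXn2r// nnegrE// expR_ge0.
Qed.

Definition cst_lb : R := (100^-1) ^+ 4.

Lemma cst_lb_gt0 : 0 < cst_lb.
Proof. by rewrite exprn_gt0. Qed.

(** Here [g] stands for [gamma sqrt n] and [lam = 1/10]. The condition [g >= 4] absorbs the additive
    constants into [g] and [g^2], and [cst_lb] makes up for the factor [32 + 576 * 18 ^+ 2 * 9]. *)
Lemma level_bound_le (m N g eps beta x q L : R) :
  2 <= m -> N = (m ^+ 2 - m) / 2 -> 4 <= g -> 0 <= x <= g -> 0 <= L <= x + 2 ->
  0 <= q -> beta ^+ 2 = 18 ^+ 2 * eps ^+ 2 ->
  q * g <= cst_lb * m ^+ 2 -> q * (eps ^+ 2 * g ^+ 2) <= cst_lb * m ^+ 2 ->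
  q * ((8 * (L + 2) + 576 * beta ^+ 2 * (2 * (L + 1) ^+ 2 + 8) +
       (8 * (L + 2) + 576 * 0 ^+ 2 * (2 * (L + 1) ^+ 2 + 8))) /
       (4 * 10^-1 * N)) <= 2^-1.
Proof.
move=> m2 NE g4 /andP[x0 xg] /andP[L0 Lx] q0 bE h1 h2.
have Ng : m ^+ 2 / 4 <= N by rewrite NE; nra.
have m20 : 0 < m ^+ 2 by rewrite exprn_gt0//; lra.
have e20 : 0 <= eps ^+ 2 by exact: sqr_ge0.
have l1 : L + 2 <= 2 * g by lra.
have l2 : 2 * (L + 1) ^+ 2 + 8 <= 9 * g ^+ 2 by nra.
have N0 : 0 < 4 * 10^-1 * N by lra.
rewrite mulrA ler_pdivrMr//.
apply: (@le_trans _ _ (32 * (q * g) +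
    576 * 18 ^+ 2 * 9 * (q * (eps ^+ 2 * g ^+ 2)))).
  have -> : 32 * (q * g) + 576 * 18 ^+ 2 * 9 * (q * (eps ^+ 2 * g ^+ 2)) =
    q * (32 * g + 576 * 18 ^+ 2 * eps ^+ 2 * (9 * g ^+ 2)) by ring.
  rewrite ler_wpM2l// bE expr0n /=.
  have : 576 * (18 ^+ 2 * eps ^+ 2) * (2 * (L + 1) ^+ 2 + 8) <=
      576 * (18 ^+ 2 * eps ^+ 2) * (9 * g ^+ 2).
    have e576 : 0 <= 576 * (18 ^+ 2 * eps ^+ 2) by lra.
    exact: (ler_wpM2l e576 l2).
  lra.
have c0 := cst_lb_gt0.
have : (32 + 576 * 18 ^+ 2 * 9) * cst_lb <= 20^-1 by rewrite /cst_lb; lra.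
move=> hc.
have : (32 + 576 * 18 ^+ 2 * 9) * cst_lb * m ^+ 2 <= 20^-1 * m ^+ 2.
  by rewrite ler_wpM2r// ltW.
lra.
Qed.

End Assembly.

Theorem theoremA1 (R : realType) :
  exists c : R, 0 < c /\
  forall (p : problem) (eps gamma : nat -> R),
    is_omega eps (fun n : nat => 1 / Num.sqrt (n%:R : R)) ->
    (forall n : nat, eps n < 5 / 100) ->
    is_omega gamma (fun n : nat => ln (n%:R : R) / Num.sqrt (n%:R : R)) ->
    exists N : nat, forall n : nat, (N <= n)%N -> admissible p n ->
    forall (s q : nat) (A : algorithm R n s),
      s%:R <= gamma n * Num.sqrt (n%:R : R) ->
      worst_case_queries A q ->
      approximates p A q (eps n) ->
      (gamma n < 1 ->
         c * Num.min (n%:R / (eps n ^+ 2 * Num.sqrt (gamma n)))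
                     (n%:R * Num.sqrt (n%:R : R) / gamma n) <= q%:R) /\
      (1 <= gamma n -> c * (n%:R / eps n ^+ 2) <= q%:R).
Proof.
exists (cst_lb R); split; first exact: cst_lb_gt0.
move=> p eps gamma omega_eps eps_small omega_gamma.
(* The constant 100 gives [eps sqrt n >= 100]; the constant 4, together with [ln n >= 1] from [N3],
   gives [gamma sqrt n >= 4]. *)
have [N1 _ hN1] := omega_eps 100 (ltr0n R 100).
have [N2 _ hN2] := omega_gamma 4 (ltr0n R 4).
have [N3 hN3] : exists N3 : nat, expR 1 <= N3%:R :> R.
  exists (Num.truncn (expR 1 : R)).+1; apply: ltW; exact: truncnS_gt.
exists (maxn (maxn N1 N2) (maxn N3 1)) => n; rewrite !geq_max.
move=> /andP[/andP[n1 n2] /andP[n3 n0]] adm s q A sg _ app.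
have {hN1 n1}eps_l := hN1 n n1; have {hN2 n2}gam_l := hN2 n n2.
rewrite /= in eps_l gam_l.
have e_small := eps_small n.
clear eps_small omega_eps omega_gamma.
move: (eps n) (gamma n) eps_l gam_l e_small sg app => {}eps {}gamma eps_l gam_l.
move=> e_small sg app.
have [m mE] : exists m : R, m = n%:R by exists n%:R.
rewrite -mE in eps_l gam_l sg *.
have m0 : 0 < m by rewrite mE ltr0n.
set r := Num.sqrt m in eps_l gam_l sg *.
have r0 : 0 < r by rewrite sqrtr_gt0.
have r2 : r ^+ 2 = m by rewrite sqr_sqrtr ?ltW.
have er : 100 <= eps * r by move: eps_l; rewrite mulrA mulr1 ler_pdivrMr.
have eps0 : 0 < eps by nra.
have eps_large : 100 ^+ 2 <= eps ^+ 2 * m.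
  by rewrite -r2 -exprMn ler_sqr ?nnegrE// mulr_ge0// ltW.
set g := gamma * r in sg *.
have g4 : 4 <= g.
  have ln1 : 1 <= ln m.
    rewrite -[leLHS]expRK ler_ln ?posrE ?expR_gt0// mE.
    by rewrite (le_trans hN3)// ler_nat.
  move: gam_l; rewrite mulrA ler_pdivrMr// -/g; lra.
have gam0 : 0 < gamma by move: g4; rewrite /g; nra.
have m2 : 2 <= m by nra.
have [beta [bE [hi [bad1 [bad0 hard]]]]] :=
  hard_instance eps0 e_small (eq_ind m (fun y => 100 ^+ 2 <= eps ^+ 2 * y) eps_large _ mE) adm.
have b1 : `|beta| < 1 by rewrite bE; lra.
have b2 : beta ^+ 2 = 18 ^+ 2 * eps ^+ 2 by rewrite -real_normK ?num_real// bE exprMn.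
have NE : #|vpair n|%:R = (m ^+ 2 - m) / 2 :> R.
  by have := card_vpair R n; rewrite -mE; lra.
have N0 : (0 < #|vpair n|)%N by rewrite -(ltr0n R) NE; nra.
have q0 : 0 <= (q%:R : R) by exact: ler0n.
have e2 : 0 < eps ^+ 2 by rewrite exprn_gt0.
have c0 := cst_lb_gt0 R.
split.
- move=> gam1; rewrite leNgt; apply/negP => qlt.
  set w := Num.sqrt gamma in qlt.
  have w0 : 0 < w by rewrite sqrtr_gt0.
  have w2 : w ^+ 2 = gamma by rewrite sqr_sqrtr ?ltW.
  have w1 : w <= 1 by nra.
  have [qa qb] : q%:R * (eps ^+ 2 * w) <= cst_lb R * m /\
      q%:R * gamma <= cst_lb R * (m * r).
    move: qlt; rewrite -ltr_pdivrMl// lt_min => /andP[ha hb]; split.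
      move: ha; rewrite ltr_pdivlMr ?mulr_gt0// -mulrA ltr_pdivrMl//; exact: ltW.
    move: hb; rewrite ltr_pdivlMr// -mulrA ltr_pdivrMl//; exact: ltW.
  have h1 : q%:R * g <= cst_lb R * m ^+ 2.
    rewrite /g mulrA.
    have -> : cst_lb R * m ^+ 2 = cst_lb R * (m * r) * r by rewrite -r2; ring.
    by rewrite ler_wpM2r// ltW.
  (* With [w = sqrt gamma <= 1], [g^2 = w^4 n <= w n]: this is where [gamma^2] is weakened to
     [sqrt gamma]. *)
  have h2 : q%:R * (eps ^+ 2 * g ^+ 2) <= cst_lb R * m ^+ 2.
    apply: (@le_trans _ _ (q%:R * (eps ^+ 2 * w) * m)).
      rewrite /g exprMn r2 -w2.
      have -> : q%:R * (eps ^+ 2 * ((w ^+ 2) ^+ 2 * m)) =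
        (q%:R * (eps ^+ 2 * w) * m) * w ^+ 3 by ring.
      by rewrite ler_piMr ?exprn_ile1 ?mulr_ge0// ltW.
    have -> : cst_lb R * m ^+ 2 = cst_lb R * m * m by ring.
    by rewrite ler_wpM2r// ltW.
  (* For [lam = 1/10] the upper bound is [1 + 1/5 + 1/2], below [1.78]. *)
  have l10 : 0 < 10^-1 :> R by lra.
  have l11 : 10^-1 <= 1 :> R by lra.
  have := memory_gap N0 (ltW b1) l10 l11 app hard.
  have xg : 0 <= (s%:R : R) <= g by rewrite ler0n.
  have := level_bound_le m2 NE g4 xg (ln_card_le R s) q0 b2 h1 h2.
  rewrite /level_bound; lra.
- move=> gam1; rewrite leNgt; apply/negP => qlt.
  have qa : q%:R * eps ^+ 2 <= cst_lb R * m.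
    by move: qlt; rewrite mulrA ltr_pdivlMr//; exact: ltW.
  have [tau tauE] : exists tau : R, tau = q%:R * beta ^+ 2 / #|vpair n|%:R.
    by eexists.
  have Npos : 0 < (#|vpair n|%:R : R) by rewrite ltr0n.
  have mtau : m * tau <= 8^-1.
    rewrite tauE b2 mulrA ler_pdivrMr// NE.
    have -> : m * (q%:R * (18 ^+ 2 * eps ^+ 2)) = 18 ^+ 2 * m * (q%:R * eps ^+ 2) by ring.
    apply: (@le_trans _ _ (18 ^+ 2 * m * (cst_lb R * m))).
      by rewrite ler_wpM2l// mulr_ge0// ltW.
    have : 18 ^+ 2 * cst_lb R <= 32^-1 by rewrite /cst_lb; lra.
    nra.
  (* For [kappa = 1/2] and [exp (m tau / 2) <= 16/15] the upper bound is [1 + 1/4 + 1/15], below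
     [1.78]. *)
  have k0 : 0 < 2^-1 :> R by lra.
  have := transcript_gap N0 b1 k0 tauE _ app hard; rewrite -mE => /(_ mtau).
  have : expR (m * tau / 2) <= 16 / 15.
    rewrite -[m * tau / 2]opprK expRN -[leRHS]invrK lef_pV2 ?posrE ?expR_gt0 ?invr_gt0//.
    by have := @expR_ge1Dx R (- (m * tau / 2)); lra.
  by lra.
Qed.
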